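(* Let $\mathcal{T}$ be a nonzero triangulated category of finite type over a field, with $(\Lambda,v)$ as in the context, let $\mathrm{Stab}_\Lambda^\dagger(\mathcal{T})$ be a connected component of $\mathrm{Stab}_\Lambda(\mathcal{T})$, and let $F\in\mathrm{Aut}(\mathcal{T})$ be a pseudo-Anosov functor with associated stability condition $\sigma_F\in\mathrm{Stab}_\Lambda^\dagger(\mathcal{T})$ and stretch factor $\rho_F$. Then: (i) $F$ is a hyperbolic isometry with respect to the action on $(\mathrm{Stab}_\Lambda^\dagger(\mathcal{T})/\mathbb{C},\bar{d_B})$; (ii) $\displaystyle \bar{d_B}(F)=\lim_{n\to\infty}\frac1n\,\bar{d_B}(\bar{\sigma_F},F^n\bar{\sigma_F})=\log\rho_F$, where $\bar{d_B}(F)$ is the translation length of $F$ on $(\mathrm{Stab}_\Lambda^\dagger(\mathcal{T})/\mathbb{C},\bar{d_B})$.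
   Context: $\mathcal{T}$ is of finite type over a field $k$: $k$-linear with $\bigoplus_i\mathrm{Hom}(E,F[i])$ finite dimensional for all $E,F$. $\mathrm{Aut}(\mathcal{T})$ is the group of autoequivalences, $K(\mathcal{T})$ the Grothendieck group. Fixed: a finitely generated free abelian group $\Lambda$, a surjection $v:K(\mathcal{T})\to\Lambda$, a norm on $\Lambda\otimes\mathbb{R}$; it is assumed that there is a homomorphism $\alpha:\mathrm{Aut}(\mathcal{T})\to\mathrm{Aut}_{\mathbb{Z}}(\Lambda)$ with $v\circ K(F)=\alpha(F)\circ v$ for all $F$ (then $\alpha$ is unique). Stability condition: a pair $\sigma=(Z,\mathcal{P})$ of a group homomorphism $Z:\Lambda\to\mathbb{C}$ and a family $\{\mathcal{P}(\phi)\}_{\phi\in\mathbb{R}}$ of full additive subcategories of $\mathcal{T}$ such that: (1) for $0\ne E\in\mathcal{P}(\phi)$, $Z(v(E))\in\mathbb{R}_{>0}e^{i\pi\phi}$; (2) $\mathcal{P}(\phi+1)=\mathcal{P}(\phi)[1]$; (3) $\mathrm{Hom}(E_1,E_2)=0$ for $E_i\in\mathcal{P}(\phi_i)$, $\phi_1>\phi_2$; (4) every $E\neq0$ has a Harder--Narasimhan filtration, i.e. exact triangles $E_{i-1}\to E_i\to A_i\to E_{i-1}[1]$, $i=1,\dots,p$, with $E_0=0$, $E_p=E$, $0\ne A_i\in\mathcal{P}(\phi_i)$, $\phi_1>\dots>\phi_p$; (5) (support property) there is $C>0$ with $\|v(E)\|<C|Z(v(E))|$ for all $0\ne E\in\mathcal{P}(\phi)$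 and all $\phi$. Set $\phi^+_\sigma(E)=\phi_1$, $\phi^-_\sigma(E)=\phi_p$, $m_\sigma(E)=\sum_i|Z(v(A_i))|$. $\mathrm{Stab}_\Lambda(\mathcal{T})$ is the set of stability conditions, topologized by the generalized metric $$d_B(\sigma,\tau)=\sup_{E\neq0}\Big\{|\phi^+_\sigma(E)-\phi^+_\tau(E)|,\ |\phi^-_\sigma(E)-\phi^-_\tau(E)|,\ \Big|\log\tfrac{m_\sigma(E)}{m_\tau(E)}\Big|\Big\}\in[0,\infty],$$ finite on each connected component. Actions. $F.\sigma=(Z_\sigma\circ\alpha(F)^{-1},\{F(\mathcal{P}_\sigma(\phi))\})$ for $F\in\mathrm{Aut}(\mathcal{T})$. The universal cover $\varphi:\widetilde{\mathrm{GL}}_+(2,\mathbb{R})\to\mathrm{GL}_+(2,\mathbb{R})$ is identified with the group of pairs $(M,f)$, $M\in\mathrm{GL}_+(2,\mathbb{R})$ and $f:\mathbb{R}\to\mathbb{R}$ increasing with $f(\phi+1)=f(\phi)+1$, such that $M$ and $f$ induce the same map on $(\mathbb{R}^2\setminus\{0\})/\mathbb{R}_{>0}=S^1=\mathbb{R}/2\mathbb{Z}$ ($\phi\leftrightarrow e^{i\pi\phi}$, $\mathbb{C}=\mathbb{R}^2$); it acts on the right by $\sigma.(M,f)=(M^{-1}\circ Z_\sigma,\{\mathcal{P}_\sigma(f(\phi))\})$. The subgroup $\mathbb{C}$ acts by $\sigma.\lambda=(e^{-i\pi\lambda}Z_\sigma,\{\mathcal{P}_\sigma(\phi+\mathrm{Re}\,\lambda)\})$.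 The actions of $\mathrm{Aut}(\mathcal{T})$ and $\mathbb{C}$ are isometric and commute; $\mathbb{C}$-orbits are closed. On $\mathrm{Stab}_\Lambda^\dagger(\mathcal{T})/\mathbb{C}$ the quotient metric is $\bar{d_B}(\bar\sigma,\bar\tau)=\inf_{\lambda\in\mathbb{C}}d_B(\sigma,\tau.\lambda)$. $F\in\mathrm{Aut}(\mathcal{T})$ is pseudo-Anosov if there exist $\sigma_F\in\mathrm{Stab}_\Lambda^\dagger(\mathcal{T})$ and $g_F\in\widetilde{\mathrm{GL}}_+(2,\mathbb{R})$ such that $F.\sigma_F=\sigma_F.g_F$ and $\varphi(g_F)=\begin{pmatrix}1/r&0\\0&r\end{pmatrix}$ or $\begin{pmatrix}r&0\\0&1/r\end{pmatrix}$ for some real $r$ with $|r|>1$; $\rho_F:=|r|$ is the stretch factor. Such $F$ preserves $\mathrm{Stab}_\Lambda^\dagger(\mathcal{T})$ and acts isometrically on $(\mathrm{Stab}_\Lambda^\dagger(\mathcal{T})/\mathbb{C},\bar{d_B})$. For an isometry $g$ of a metric space $(X,d)$, the translation length is $d(g)=\inf_{x\in X}d(x,g.x)$; $g$ is hyperbolic if $d(g)>0$ and $d(g)=d(x,g.x)$ for some $x\in X$. *)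

(* Defs.v *)
From HB Require Import structures.
From mathcomp Require Import all_boot all_order all_algebra.
From mathcomp Require Import generic_quotient ring_quotient complex freeg.
From mathcomp Require Import all_classical all_reals all_analysis.
Import numFieldNormedType.Exports.

Set Implicit Arguments.
Unset Strict Implicit.
Unset Printing Implicit Defensive.

Import Order.TTheory GRing.Theory Num.Theory.
Local Open Scope ring_scope.
Local Open Scope classical_set_scope.

Reserved Notation "g \oc f" (at level 40, left associativity).

Record lincat (k : fieldType) := LinCat {
  Ob : Type;
  Hom : Ob -> Ob -> lmodType k;
  idm : forall X, Hom X X;
  comp : forall X Y Z, Hom Y Z -> Hom X Y -> Hom X Z;
  comp_idl : forall X Y (f : Hom X Y), comp (idm Y) f = f;
  comp_idr : forall X Y (f : Hom X Y), comp f (idm X) = f;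
  compA : forall W X Y Z (h : Hom Y Z) (g : Hom X Y) (f : Hom W X),
    comp h (comp g f) = comp (comp h g) f;
  comp_linl : forall X Y Z (f : Hom X Y),
    linear (fun g : Hom Y Z => comp g f);
  comp_linr : forall X Y Z (g : Hom Y Z),
    linear (fun f : Hom X Y => comp g f)
}.
Arguments Hom {k C} : rename.
Arguments idm {k C} X : rename.
Arguments comp {k C X Y Z} : rename.
Notation "g \oc f" := (comp g f).

HB.instance Definition _ (k : fieldType) (C : lincat k) := gen_eqMixin (Ob C).
HB.instance Definition _ (k : fieldType) (C : lincat k) :=
  gen_choiceMixin (Ob C).

Section Categories.
Variables (k : fieldType) (C : lincat k).

Definition is_iso (X Y : Ob C) (f : Hom X Y) : Prop :=
  exists g : Hom Y X, g \oc f = idm X /\ f \oc g = idm Y.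

Definition isom (X Y : Ob C) : Prop := exists f : Hom X Y, is_iso f.

Definition is_zero (X : Ob C) : Prop := idm X = 0.

Definition is_biproduct (A B S : Ob C) : Prop :=
  exists (i1 : Hom A S) (i2 : Hom B S) (p1 : Hom S A) (p2 : Hom S B),
    [/\ p1 \oc i1 = idm A, p2 \oc i2 = idm B, p1 \oc i2 = 0, p2 \oc i1 = 0
      & i1 \oc p1 + i2 \oc p2 = idm S].

Definition is_additive_category : Prop :=
  (exists X, is_zero X) /\ (forall A B, exists S, is_biproduct A B S).

(* Full subcategories are given by their sets of objects, and are strict, i.e.
   closed under isomorphism. *)
Definition additive_subcategory (P : set (Ob C)) : Prop :=
  [/\ forall X, is_zero X -> P X,
      forall A B S, is_biproduct A B S -> P A -> P B -> P S
    & forall X Y, isom X Y -> P X -> P Y].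

End Categories.

Record functor (k : fieldType) (C D : lincat k) := Functor {
  fob :> Ob C -> Ob D;
  fmap : forall X Y, Hom X Y -> Hom (fob X) (fob Y);
  fmap_linear : forall X Y, linear (@fmap X Y);
  fmap_id : forall X, fmap (idm X) = idm (fob X);
  fmap_comp : forall X Y Z (g : Hom Y Z) (f : Hom X Y),
    fmap (g \oc f) = fmap g \oc fmap f
}.
Arguments fmap {k C D} F {X Y} : rename.

Section Functors.
Variable k : fieldType.

Definition id_functor (C : lincat k) : functor C C :=
  @Functor k C C id (fun _ _ f => f) (fun _ _ _ _ _ => erefl)
    (fun _ => erefl) (fun _ _ _ _ _ => erefl).

Variables C D E : lincat k.

Lemma comp_functor_linear (G : functor D E) (F : functor C D) X Y :
  linear (fun f : Hom X Y => fmap G (fmap F f)).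
Proof. by move=> a f g; rewrite !fmap_linear. Qed.

Lemma comp_functor_id (G : functor D E) (F : functor C D) X :
  fmap G (fmap F (idm X)) = idm (G (F X)).
Proof. by rewrite !fmap_id. Qed.

Lemma comp_functor_comp (G : functor D E) (F : functor C D) X Y Z
    (g : Hom Y Z) (f : Hom X Y) :
  fmap G (fmap F (g \oc f)) = fmap G (fmap F g) \oc fmap G (fmap F f).
Proof. by rewrite !fmap_comp. Qed.

Definition comp_functor (G : functor D E) (F : functor C D) : functor C E :=
  @Functor k C E (fun X => G (F X)) (fun _ _ f => fmap G (fmap F f))
    (@comp_functor_linear G F) (comp_functor_id G F)
    (@comp_functor_comp G F).

End Functors.

Definition nat_iso (k : fieldType) (C D : lincat k) (F G : functor C D) :
    Prop :=
  exists eta : forall X, Hom (F X) (G X),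
    (forall X, is_iso (eta X)) /\
    (forall X Y (f : Hom X Y), eta Y \oc fmap F f = fmap G f \oc eta X).

Definition quasi_inverse (k : fieldType) (C : lincat k) (F G : functor C C) :
    Prop :=
  nat_iso (comp_functor G F) (id_functor C) /\
  nat_iso (comp_functor F G) (id_functor C).

(* The shift is only required to be an autoequivalence, with a chosen
   quasi-inverse. *)
Record tricat (k : fieldType) := TriCat {
  tri_cat :> lincat k;
  tri_additive : is_additive_category tri_cat;
  shift : functor tri_cat tri_cat;
  unshift : functor tri_cat tri_cat;
  shiftK : quasi_inverse shift unshift;
  dist : forall X Y Z : Ob tri_cat,
    Hom X Y -> Hom Y Z -> Hom Z (shift X) -> Prop;
  dist_iso : forall (X Y Z X' Y' Z' : Ob tri_cat)
      (f : Hom X Y) (g : Hom Y Z) (h : Hom Z (shift X))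
      (f' : Hom X' Y') (g' : Hom Y' Z') (h' : Hom Z' (shift X'))
      (a : Hom X X') (b : Hom Y Y') (c : Hom Z Z'),
    is_iso a -> is_iso b -> is_iso c ->
    b \oc f = f' \oc a -> c \oc g = g' \oc b ->
    fmap shift a \oc h = h' \oc c ->
    dist f g h -> dist f' g' h';
  dist_id : forall X Z : Ob tri_cat, is_zero Z ->
    dist (idm X) (0 : Hom X Z) 0;
  dist_cone : forall (X Y : Ob tri_cat) (f : Hom X Y),
    exists Z (g : Hom Y Z) (h : Hom Z (shift X)), dist f g h;
  dist_rot : forall (X Y Z : Ob tri_cat)
      (f : Hom X Y) (g : Hom Y Z) (h : Hom Z (shift X)),
    dist f g h <-> dist g h (- fmap shift f);
  dist_mor : forall (X Y Z X' Y' Z' : Ob tri_cat)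
      (f : Hom X Y) (g : Hom Y Z) (h : Hom Z (shift X))
      (f' : Hom X' Y') (g' : Hom Y' Z') (h' : Hom Z' (shift X'))
      (a : Hom X X') (b : Hom Y Y'),
    dist f g h -> dist f' g' h' -> b \oc f = f' \oc a ->
    exists c : Hom Z Z', c \oc g = g' \oc b /\ fmap shift a \oc h = h' \oc c;
  dist_octahedron : forall (X Y Z A B D : Ob tri_cat)
      (f : Hom X Y) (f1 : Hom Y A) (f2 : Hom A (shift X))
      (g : Hom Y Z) (g1 : Hom Z B) (g2 : Hom B (shift Y))
      (h1 : Hom Z D) (h2 : Hom D (shift X)),
    dist f f1 f2 -> dist g g1 g2 -> dist (g \oc f) h1 h2 ->
    exists (u : Hom A D) (w : Hom D B),
      [/\ dist u w (fmap shift f1 \oc g2),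
          u \oc f1 = h1 \oc g, h2 \oc u = f2,
          w \oc h1 = g1 & g2 \oc w = fmap shift f \oc h2]
}.
Arguments shift {k T} : rename.
Arguments unshift {k T} : rename.
Arguments dist {k T X Y Z} : rename.

Section FiniteType.
Variable k : fieldType.

Definition shiftz (T : tricat k) (i : int) (X : Ob T) : Ob T :=
  match i with
  | Posz n => iter n (@shift k T) X
  | Negz n => iter n.+1 (@unshift k T) X
  end.

(* The elements of the direct sum of the V i are the finitely supported
   families. *)
Definition in_direct_sum (V : int -> lmodType k) (x : forall i, V i) : Prop :=
  exists N : nat, forall i : int, (N < `|i|)%N -> x i = 0.

Definition direct_sum_fin_dim (V : int -> lmodType k) : Prop :=
  exists (n : nat) (b : 'I_n -> forall i, V i),
    (forall j, in_direct_sum (b j)) /\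
    forall x : (forall i, V i), in_direct_sum x ->
      exists c : 'I_n -> k, forall i, x i = \sum_j c j *: b j i.

Definition finite_type (T : tricat k) : Prop :=
  forall E F : Ob T, direct_sum_fin_dim (fun i => Hom E (shiftz i F)).

Definition nonzero_category (T : tricat k) : Prop :=
  exists E : Ob T, ~ is_zero E.

End FiniteType.

Section GrothendieckGroup.
Variables (k : fieldType) (T : tricat k).

Inductive triangle_relation : {freeg (Ob T)} -> Prop :=
| TriRel0 : triangle_relation 0
| TriRelB x y : triangle_relation x -> triangle_relation y ->
    triangle_relation (x - y)
| TriRelT (X Y Z : Ob T) (f : Hom X Y) (g : Hom Y Z) (h : Hom Z (shift X)) :
    dist f g h -> triangle_relation (<<Y>> - <<X>> - <<Z>>).

Definition triangle_relations : {pred {freeg (Ob T)}} :=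
  fun x => `[< triangle_relation x >].

Lemma triangle_relations_zmod_closed : zmod_closed triangle_relations.
Proof.
split=> [|x y /asboolP hx /asboolP hy]; apply/asboolP; first exact: TriRel0.
exact: TriRelB.
Qed.

HB.instance Definition _ := GRing.isZmodClosed.Build {freeg (Ob T)}
  triangle_relations triangle_relations_zmod_closed.

Definition K0 : zmodType := Quotient.quot triangle_relations.

Definition K0_pi (x : {freeg (Ob T)}) : K0 :=
  (\pi_(Quotient.quot triangle_relations) x)%qT.

Definition K0_class (E : Ob T) : K0 := K0_pi <<E>>.

End GrothendieckGroup.

Section Autoequivalences.
Variables (k : fieldType) (T : tricat k).

Definition exact_functor (F : functor T T) : Prop :=
  exists theta : forall X, Hom (F (shift X)) (shift (F X)),
    [/\ forall X, is_iso (theta X),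
        forall X Y (f : Hom X Y),
          theta Y \oc fmap F (fmap shift f)
            = fmap shift (fmap F f) \oc theta X
      & forall (X Y Z : Ob T)
          (f : Hom X Y) (g : Hom Y Z) (h : Hom Z (shift X)),
          dist f g h -> dist (fmap F f) (fmap F g) (theta X \oc fmap F h)].

Record autoeq := AutoEq {
  aut_functor :> functor T T;
  aut_exact : exact_functor aut_functor;
  aut_equiv : exists G : functor T T, quasi_inverse aut_functor G
}.

(* K(F); well defined by the exactness of F, see K0_map_class and
   K0_map_additive. *)
Definition freeg_push (F : Ob T -> Ob T) : {freeg (Ob T)} -> {freeg (Ob T)} :=
  fglift (fun E => <<F E>> : {freeg (Ob T)}).

Definition K0_map (F : Ob T -> Ob T) (x : K0 T) : K0 T :=
  K0_pi (freeg_push F (repr x)).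

End Autoequivalences.

Section GrothendieckGroupMaps.
Variables (k : fieldType) (T : tricat k) (F : autoeq T).
Local Open Scope quotient_scope.

Lemma freeg_pushB : {morph freeg_push F : x y / x - y}.
Proof. exact: lift_is_additive. Qed.

Lemma freeg_pushU (E : Ob T) : freeg_push F <<E>> = <<F E>>.
Proof. by rewrite /freeg_push liftU scale1r. Qed.

Lemma triangle_relation_push x :
  triangle_relation x -> triangle_relation (freeg_push F x).
Proof.
elim=> [|{}x y _ hx _ hy|X Y Z f g h fgh].
- by rewrite -(subrr 0) freeg_pushB subrr; exact: TriRel0.
- by rewrite freeg_pushB; exact: TriRelB.
- have [theta [_ _ hd]] := aut_exact F.
  by rewrite !freeg_pushB !freeg_pushU; exact: TriRelT (hd _ _ _ _ _ _ fgh).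
Qed.

Lemma K0_piP (x y : {freeg (Ob T)}) :
  K0_pi x = K0_pi y <-> triangle_relation (x - y).
Proof.
split=> [/eqP|h].
  by rewrite /K0_pi -Quotient.idealrBE => /asboolP.
by apply/eqP; rewrite /K0_pi -Quotient.idealrBE; apply/asboolP.
Qed.

Lemma K0_piB : {morph @K0_pi k T : x y / x - y}.
Proof. by move=> x y; rewrite /K0_pi pi_addr pi_oppr. Qed.

Lemma K0_map_pi (x : {freeg (Ob T)}) :
  K0_map F (K0_pi x) = K0_pi (freeg_push F x).
Proof.
apply/K0_piP; rewrite -freeg_pushB; apply: triangle_relation_push.
by apply/K0_piP; rewrite /K0_pi reprK.
Qed.

Lemma K0_map_class (E : Ob T) : K0_map F (K0_class E) = K0_class (F E).
Proof. by rewrite K0_map_pi freeg_pushU. Qed.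

Lemma K0_map_additive : {morph K0_map F : x y / x - y}.
Proof.
elim/quotW=> x; elim/quotW=> y.
by rewrite -!/(K0_pi _) -K0_piB !K0_map_pi freeg_pushB K0_piB.
Qed.

Lemma K0_dist (X Y Z : Ob T) (f : Hom X Y) (g : Hom Y Z)
    (h : Hom Z (shift X)) :
  dist f g h -> K0_class Y - K0_class X = K0_class Z.
Proof.
by move=> fgh; rewrite /K0_class -K0_piB; apply/K0_piP; exact: TriRelT fgh.
Qed.

End GrothendieckGroupMaps.

(* V, together with iota, is the tensor product L (x) R of a finitely
   generated free abelian group L: some Z-basis of L is sent by iota to an
   R-basis of V.  The norm on L (x) R is then the norm of V. *)
Definition is_scalar_extension (R : realType) (L : zmodType)
    (V : normedModType R) (iota : {additive L -> V}) : Prop :=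
  exists (n : nat) (b : 'I_n -> L),
    (forall x : L, exists! c : {ffun 'I_n -> int}, x = \sum_i b i *~ c i) /\
    (forall y : V, exists! c : {ffun 'I_n -> R},
      y = \sum_i c i *: iota (b i)).

Record zaut (L : zmodType) := ZAut {
  zaut_fun :> {additive L -> L};
  zaut_inv : L -> L;
  zaut_funK : cancel zaut_fun zaut_inv;
  zaut_invK : cancel zaut_inv zaut_fun
}.

(* alpha is a homomorphism on the group of autoequivalences, i.e. of exact
   autoequivalences up to natural isomorphism. *)
Definition aut_morphism (k : fieldType) (T : tricat k) (L : zmodType)
    (alpha : autoeq T -> zaut L) : Prop :=
  forall F G H : autoeq T, nat_iso H (comp_functor F G) ->
    alpha H =1 alpha F \o alpha G.

Section ComplexPlane.
Variable R : realType.
Local Open Scope complex_scope.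

Definition cexp (z : R[i]) : R[i] :=
  (expR (complex.Re z))%:C * (cos (complex.Im z) +i* sin (complex.Im z)).

Definition cphase (phi : R) : R[i] := cexp (0 +i* (pi * phi)).

Definition cmod (z : R[i]) : R := ComplexField.Normc.normc z.

Definition mx_act (M : 'M[R]_2) (z : R[i]) : R[i] :=
  (M 0 0 * complex.Re z + M 0 1 * complex.Im z) +i* (M 1 0 * complex.Re z + M 1 1 * complex.Im z).

Definition diag2 (a b : R) : 'M[R]_2 :=
  \matrix_(i, j) (if i == j then (if i == 0 then a else b) else 0).

Record GLtilde := GLTilde {
  gl_mx : 'M[R]_2;
  gl_fun : R -> R;
  gl_det : 0 < \det gl_mx;
  gl_incr : {homo gl_fun : x y / x < y};
  gl_period : forall phi, gl_fun (phi + 1) = gl_fun phi + 1;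
  gl_compat : forall phi, exists2 c : R, 0 < c &
    mx_act gl_mx (cphase phi) = c%:C * cphase (gl_fun phi)
}.

End ComplexPlane.

Section Stability.
Variables (R : realType) (k : fieldType) (T : tricat k).
Variables (L : zmodType) (V : normedModType R).
Variables (iota : {additive L -> V}) (v : {additive K0 T -> L}).
Local Open Scope complex_scope.

Definition vcl (E : Ob T) : L := v (K0_class E).

Definition prestab : Type := ((L -> R[i]) * (R -> set (Ob T)))%type.

Implicit Types (sigma tau : prestab) (P : R -> set (Ob T)).

(* s lists the pairs (phi_i, A_i), i = 1, ..., p. *)
Definition HN_filtration P (E : Ob T) (s : seq (R * Ob T)) : Prop :=
  exists Ei : nat -> Ob T,
    [/\ is_zero (Ei 0%N), Ei (size s) = E,
        sorted (fun x y : R => y < x) [seq a.1 | a <- s]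
      & forall i, (i < size s)%N ->
          let phi := (nth (0, E) s i).1 in
          let A := (nth (0, E) s i).2 in
          [/\ ~ is_zero A, P phi A &
            exists (f : Hom (Ei i) (Ei i.+1)) (g : Hom (Ei i.+1) A)
              (h : Hom A (shift (Ei i))), dist f g h]].

Definition is_stability sigma : Prop :=
  let: (Z, P) := sigma in
  [/\ {morph Z : x y / x + y} /\ (forall phi, additive_subcategory (P phi)),
      forall phi E, ~ is_zero E -> P phi E ->
        exists2 c : R, 0 < c & Z (vcl E) = c%:C * cphase phi,
      forall phi E, P (phi + 1) E <->
        exists2 E', P phi E' & isom E (shift E'),
      forall phi1 phi2 E1 E2, phi2 < phi1 -> P phi1 E1 -> P phi2 E2 ->
        forall f : Hom E1 E2, f = 0
    & (forall E, ~ is_zero E -> exists s, HN_filtration P E s) /\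
      (exists2 C : R, 0 < C & forall phi E, ~ is_zero E -> P phi E ->
        `|iota (vcl E)| < C * cmod (Z (vcl E)))].

Definition HN sigma (E : Ob T) : seq (R * Ob T) :=
  xget [::] [set s | HN_filtration sigma.2 E s].

Definition phi_plus sigma E : R := head 0 [seq a.1 | a <- HN sigma E].

Definition phi_minus sigma E : R := last 0 [seq a.1 | a <- HN sigma E].

Definition mass sigma E : R := \sum_(a <- HN sigma E) cmod (sigma.1 (vcl a.2)).

Definition dB sigma tau : \bar R :=
  ereal_sup (\bigcup_(E in [set E | ~ is_zero E])
    [set (`|phi_plus sigma E - phi_plus tau E|)%:E;
         (`|phi_minus sigma E - phi_minus tau E|)%:E;
         (`|ln (mass sigma E / mass tau E)|)%:E]).

Record stab := Stab {
  stab_val :> prestab;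
  stabP : is_stability stab_val
}.

HB.instance Definition _ := gen_eqMixin stab.
HB.instance Definition _ := gen_choiceMixin stab.

Definition dB_open (U : set stab) : Prop :=
  forall sigma : stab, U sigma -> exists2 e : R, 0 < e &
    forall tau : stab, (dB sigma tau < e%:E)%E -> U tau.

Lemma dB_openT : dB_open setT.
Proof. by move=> s _; exists 1. Qed.

Lemma dB_openI : setI_closed dB_open.
Proof.
move=> A B oA oB s [/oA[e e0 he] /oB[d d0 hd]].
exists (Num.min e d); first by rewrite lt_min e0.
move=> t; rewrite EFin_min lt_min => /andP[te td].
by split; [exact: he|exact: hd].
Qed.

Lemma dB_open_bigU (I : Type) (f : I -> set stab) :
  (forall i, dB_open (f i)) -> dB_open (\bigcup_i f i).
Proof.
move=> of_ s [i _ fis]; have [e e0 he] := of_ i s fis.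
by exists e => // t /he fit; exists i.
Qed.

HB.instance Definition _ :=
  isOpenTopological.Build stab dB_openT dB_openI dB_open_bigU.

Definition is_component (X : set stab) : Prop :=
  exists sigma : stab, X = connected_component [set: stab] sigma.

Definition actC sigma (lambda : R[i]) : prestab :=
  (fun x => cexp (- ((0 +i* pi) * lambda)) * sigma.1 x,
   fun phi => sigma.2 (phi + complex.Re lambda)).

Definition actGL sigma (g : GLtilde R) : prestab :=
  (fun x => mx_act (invmx (gl_mx g)) (sigma.1 x),
   fun phi => sigma.2 (gl_fun g phi)).

Variable alpha : autoeq T -> zaut L.

Definition actAut (F : autoeq T) sigma : prestab :=
  (fun x => sigma.1 (zaut_inv (alpha F) x),
   fun phi => [set E | exists2 E', sigma.2 phi E' & isom E (F E')]).

(* The points of the quotient by C are the C-orbits. *)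
Definition orbitC sigma : set prestab := range (actC sigma).

Definition quotientC (X : set stab) : set (set prestab) :=
  [set orbitC sigma | sigma in X].

Definition orbit_repr (A : set prestab) : prestab :=
  xget ((fun=> 0), (fun=> set0)) A.

Definition dB_quot (A B : set prestab) : \bar R :=
  ereal_inf [set dB (orbit_repr A) (actC (orbit_repr B) lambda)
            | lambda in [set: R[i]]].

Definition actAut_quot (F : autoeq T) (A : set prestab) : set prestab :=
  actAut F @` A.

Definition pseudo_Anosov (F : autoeq T) (sigma : prestab) (rho : R) : Prop :=
  exists (g : GLtilde R) (r : R),
    [/\ 1 < `|r|, actAut F sigma = actGL sigma g,
        gl_mx g = diag2 r^-1 r \/ gl_mx g = diag2 r r^-1
      & rho = `|r|].

End Stability.

Section Isometries.
Variables (R : realType) (M : Type) (X : set M) (d : M -> M -> \bar R).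
Variable g : M -> M.
Local Open Scope ereal_scope.

Definition is_isometry : Prop :=
  set_bij X X g /\ forall x y, X x -> X y -> d (g x) (g y) = d x y.

Definition translation_length : \bar R := ereal_inf [set d x (g x) | x in X].

Definition hyperbolic_isometry : Prop :=
  [/\ is_isometry, 0 < translation_length
    & exists2 x, X x & translation_length = d x (g x)].

End Isometries.

(* Main.v *)
(* Write [sigma = sigma_F], [t = +- log rho], and let [sigma . s] be the action of
   [diag(e^-s, e^s)], lifted to the universal cover.  The equation for [sigma]
   says that [F sigma = sigma . t] up to the action of an integer in [C], and [F]
   commutes with both actions, so [F^n sigma = sigma . n t] modulo [C].

   A stretch of [R^2] by [e^s] distorts lengths by at most [e^|s|] and angles by at
   most [|s|]; as [sigma] and [sigma . s] have the same Harder-Narasimhan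
   filtrations, [d(sigma, sigma . s) <= |s|].  Conversely, [F] permutes the
   semistable objects of [sigma] up to the phase and moves their central charges
   along hyperbolas [x y = const].  The support property forbids arbitrarily small
   central charges, hence central charges on the axes, so there are semistable
   objects with central charges as close as desired to either axis.  Their masses
   are multiplied by nearly [e^s] and [e^-s], and rescaling by [C] cannot balance
   both, so [d(sigma, sigma . s lambda) >= |s|] for all [lambda].  The points
   [F^n sigma] thus drift at speed exactly [|t|], and no point of the quotient can
   be displaced by less than that.

   Autoequivalences act on the component since they act by isometries and
   [s |-> sigma . s] is a path from [sigma] to [F sigma] modulo [C]. *)
Require Import Defs.
From HB Require Import structures.
From mathcomp Require Import all_boot all_order all_algebra.
From mathcomp Require Import all_classical all_reals all_analysis.
From mathcomp Require Import complex ring lra.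
Import numFieldNormedType.Exports.
Import Order.TTheory GRing.Theory Num.Theory.
(* Some names of Defs, such as [Hom], are also defined by MathComp. *)
Import Defs.
Set Implicit Arguments.
Unset Strict Implicit.
Unset Printing Implicit Defensive.
Local Open Scope ring_scope.
Local Open Scope classical_set_scope.

(** * Linear and triangulated categories *)

Section LinearMaps.
Variables (k : fieldType) (U W : lmodType k) (f : U -> W).
Hypothesis f_lin : linear f.

Lemma lin0 : f 0 = 0.
Proof.
have := f_lin (-1) 0 0.
by rewrite scaler0 addr0 scaleN1r addNr.
Qed.

Lemma linN x : f (- x) = - f x.
Proof. by have := f_lin (-1) x 0; rewrite !scaleN1r !addr0 lin0 addr0. Qed.

Lemma linD x y : f (x + y) = f x + f y.
Proof. by have := f_lin 1 x y; rewrite !scale1r. Qed.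

Lemma linB x y : f (x - y) = f x - f y.
Proof. by rewrite linD linN. Qed.

End LinearMaps.

Section LinearCategories.
Variables (k : fieldType) (C : lincat k).
Implicit Types X Y Z W : Ob C.

Lemma comp0l X Y Z (f : Hom X Y) : (0 : Hom Y Z) \oc f = 0.
Proof. exact: (lin0 (comp_linl f)). Qed.

Lemma comp0r X Y Z (f : Hom Y Z) : f \oc (0 : Hom X Y) = 0.
Proof. exact: (lin0 (comp_linr f)). Qed.

Lemma compNl X Y Z (f : Hom X Y) (g : Hom Y Z) : (- g) \oc f = - (g \oc f).
Proof. exact: (linN (comp_linl f)). Qed.

Lemma compNr X Y Z (f : Hom X Y) (g : Hom Y Z) : g \oc (- f) = - (g \oc f).
Proof. exact: (linN (comp_linr g)). Qed.

Lemma compBl X Y Z (f : Hom X Y) (g h : Hom Y Z) :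
  (g - h) \oc f = g \oc f - h \oc f.
Proof. exact: (linB (comp_linl f)). Qed.

Lemma compBr X Y Z (g : Hom Y Z) (f h : Hom X Y) :
  g \oc (f - h) = g \oc f - g \oc h.
Proof. exact: (linB (comp_linr g)). Qed.

Lemma compDl X Y Z (f : Hom X Y) (g h : Hom Y Z) :
  (g + h) \oc f = g \oc f + h \oc f.
Proof. exact: (linD (comp_linl f)). Qed.

Lemma compDr X Y Z (g : Hom Y Z) (f h : Hom X Y) :
  g \oc (f + h) = g \oc f + g \oc h.
Proof. exact: (linD (comp_linr g)). Qed.

Lemma zero_homl X Y (f : Hom X Y) : is_zero X -> f = 0.
Proof. by move=> X0; rewrite -(comp_idr f) X0 comp0r. Qed.

Lemma is_iso_id X : is_iso (idm X).
Proof. by exists (idm X); rewrite !comp_idl. Qed.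

Lemma is_iso_comp X Y Z (g : Hom Y Z) (f : Hom X Y) :
  is_iso g -> is_iso f -> is_iso (g \oc f).
Proof.
move=> [g' [gK g'K]] [f' [fK f'K]]; exists (f' \oc g'); split.
  by rewrite -compA (compA g') gK comp_idl.
by rewrite -compA (compA f) f'K comp_idl.
Qed.

Lemma isom_refl X : isom X X.
Proof. by exists (idm X); exact: is_iso_id. Qed.

Lemma isom_sym X Y : isom X Y -> isom Y X.
Proof. by move=> [f [g [gf fg]]]; exists g, f. Qed.

Lemma isom_trans Y X Z : isom X Y -> isom Y Z -> isom X Z.
Proof. by move=> [f hf] [g hg]; exists (g \oc f); exact: is_iso_comp. Qed.

Lemma isom_zero X Y : isom X Y -> is_zero X -> is_zero Y.
Proof.
by move=> [f [g [_ fg]]] X0; rewrite /is_zero -fg (zero_homl f X0) comp0l.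
Qed.

Lemma isom_nonzero X Y : isom X Y -> ~ is_zero X -> ~ is_zero Y.
Proof. by move=> /isom_sym XY; apply: contra_not; exact: isom_zero. Qed.

Lemma is_iso_split X Y (f : Hom X Y) (g g' : Hom Y X) :
  g \oc f = idm X -> f \oc g' = idm Y -> is_iso f.
Proof.
move=> gf fg'; exists g; split=> //.
have -> // : g = g'.
by rewrite -(comp_idr g) -fg' compA gf comp_idl.
Qed.

(* The inverse of [1 + e] with [e ^ 2 = 0] is [1 - e]. *)
Lemma is_iso_unipotent X (f : Hom X X) :
  (f - idm X) \oc (f - idm X) = 0 -> is_iso f.
Proof.
have -> : f = idm X + (f - idm X) by rewrite addrC subrK.
move: (f - idm X) => e; rewrite [idm X + e]addrC addrK => ee.
exists (idm X - e); rewrite !(compBl, compBr, compDl, compDr) ee.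
rewrite !comp_idl !comp_idr !add0r ?subr0 ?sub0r.
by split; rewrite addrC ?addrA ?addKr ?addNr ?add0r ?subrK.
Qed.

End LinearCategories.

Section LinearFunctors.
Variables (k : fieldType) (C : lincat k).
Implicit Types (F G : functor C C) (X Y Z : Ob C).

Lemma fmap_iso F X Y (f : Hom X Y) : is_iso f -> is_iso (fmap F f).
Proof.
by move=> [g [gf fg]]; exists (fmap F g); rewrite -!fmap_comp gf fg !fmap_id.
Qed.

Lemma functor_isom F X Y : isom X Y -> isom (F X) (F Y).
Proof. by move=> [f hf]; exists (fmap F f); exact: fmap_iso. Qed.

Lemma functor_zero F X : is_zero X -> is_zero (F X).
Proof.
by move=> X0; rewrite /is_zero -fmap_id X0 (lin0 (@fmap_linear _ _ _ F _ _)).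
Qed.

Lemma functor_biproduct F A B S :
  is_biproduct A B S -> is_biproduct (F A) (F B) (F S).
Proof.
move=> [i1 [i2 [p1 [p2 [e1 e2 e3 e4 e5]]]]].
have F_lin X Y := @fmap_linear _ _ _ F X Y.
exists (fmap F i1), (fmap F i2), (fmap F p1), (fmap F p2).
split; rewrite -!fmap_comp ?e1 ?e2 ?e3 ?e4 ?fmap_id ?(lin0 (F_lin _ _)) //.
by rewrite -(linD (F_lin _ _)) e5 fmap_id.
Qed.

Variables (F G : functor C C).
Hypothesis FG : quasi_inverse F G.

Lemma quasi_inverse_isoml X : isom (G (F X)) X.
Proof. by case: FG => [[eta [h _]] _]; exists (eta X); exact: h. Qed.

Lemma quasi_inverse_isomr X : isom (F (G X)) X.
Proof. by case: FG => [_ [eta [h _]]]; exists (eta X); exact: h. Qed.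

Lemma quasi_inverse_sym : quasi_inverse G F.
Proof. by case: FG. Qed.

Lemma quasi_inverse_faithful X Y (f g : Hom X Y) :
  fmap F f = fmap F g -> f = g.
Proof.
case: FG => [[eta [eta_iso nat]] _] fg.
have [e [_ he]] := eta_iso X.
have := nat _ _ f; rewrite /= fg (nat _ _ g) /= => /(congr1 (fun u => u \oc e)).
by rewrite -!compA he !comp_idr.
Qed.

End LinearFunctors.

Section Equivalences.
Variables (k : fieldType) (C : lincat k) (F G : functor C C).
Hypothesis FG : quasi_inverse F G.

(** The preimage is [fmap G h] conjugated by [eta]. As [G] is faithful, the equality may be checked
    after applying [G], where it is naturality of [eta]. *)
Lemma quasi_inverse_full X Y (h : Hom (F X) (F Y)) :
  exists f : Hom X Y, fmap F f = h.
Proof.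
have [[eta [eta_iso nat]] _] := FG.
have [e [he eh]] := eta_iso X; have [e' [he' _]] := eta_iso Y.
exists (eta Y \oc fmap G h \oc e).
apply: (quasi_inverse_faithful (quasi_inverse_sym FG)).
have := nat _ _ (eta Y \oc fmap G h \oc e); rewrite /= -!compA he comp_idr.
by move=> /(congr1 (fun u => e' \oc u)); rewrite !compA he' !comp_idl.
Qed.

Lemma quasi_inverse_isom_reflect X Y : isom (F X) (F Y) -> isom X Y.
Proof.
move=> FXY; apply: (isom_trans (isom_sym (quasi_inverse_isoml FG X))).
by apply: (isom_trans (functor_isom G FXY)); exact: quasi_inverse_isoml FG Y.
Qed.

Lemma quasi_inverse_zero_reflect X : is_zero (F X) -> is_zero X.
Proof.
move=> /(functor_zero G); apply: isom_zero; exact: quasi_inverse_isoml FG X.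
Qed.

End Equivalences.

(** * Exactness of Hom on triangles, uniqueness of cones *)

Section Triangles.
Variables (k : fieldType) (T : tricat k).
Implicit Types X Y Z W : Ob T.

Lemma shift_map0 X Y : fmap shift (0 : Hom X Y) = 0.
Proof. exact: (lin0 (@fmap_linear _ _ _ shift X Y)). Qed.

Lemma dist_idr X W : is_zero X ->
  dist (0 : Hom X W) (idm W) (0 : Hom W (shift X)).
Proof.
move=> X0; apply/dist_rot; rewrite shift_map0 oppr0.
exact/dist_id/functor_zero.
Qed.

Section Exactness.
Variables (X Y Z : Ob T) (f : Hom X Y) (g : Hom Y Z) (h : Hom Z (shift X)).
Hypothesis fgh : dist f g h.

(** Map the triangle to [N -> W -> W] with [N] zero: the filler given by [dist_mor] is the factor
    sought. *)
Lemma dist_factor W (u : Hom Y W) : u \oc f = 0 -> exists c, u = c \oc g.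
Proof.
move=> uf; have [[N N0] _] := tri_additive T.
have [|c [cg _]] := dist_mor (a := 0) (b := u) fgh (dist_idr W N0).
  by rewrite uf comp0r.
by exists c; rewrite cg comp_idl.
Qed.

(** Since [dist_mor] only fills in the third map, both triangles are rotated first. The filler is a
    map between shifts, and it descends because [shift] is full and faithful. *)
Lemma dist_lift W (u : Hom W Y) : g \oc u = 0 -> exists c, u = f \oc c.
Proof.
move=> gu; have [[N N0] _] := tri_additive T.
have /dist_rot d := dist_id W N0; have /dist_rot d' := fgh.
have [|c [_]] := dist_mor (a := u) (b := 0) d d'.
  by rewrite gu comp0l.
have [c' <-] := quasi_inverse_full (shiftK T) c.
rewrite fmap_id compNl compNr comp_idr -fmap_comp => /oppr_inj.
by move=> /(quasi_inverse_faithful (shiftK T)) ->; exists c'.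
Qed.

End Exactness.

Lemma dist_factor_shift X Y Z (f : Hom X Y) (g : Hom Y Z) (h : Hom Z (shift X))
    W (u : Hom Z W) :
  dist f g h -> u \oc g = 0 -> exists c, u = c \oc h.
Proof. by move=> /dist_rot d ug; have [c ->] := dist_factor d ug; exists c. Qed.

Lemma dist_lift_shift X Y Z (f : Hom X Y) (g : Hom Y Z) (h : Hom Z (shift X))
    W (u : Hom W X) :
  dist f g h -> f \oc u = 0 -> exists c, fmap shift u = h \oc c.
Proof.
move=> /dist_rot/dist_rot d fu; apply: (dist_lift d).
by rewrite compNl -fmap_comp fu shift_map0 oppr0.
Qed.

(** The difference [e - idm Z] kills [g], so it factors through [h]; it is also killed by [h] on the
    left. Hence its square is zero and [e] is unipotent. *)
Lemma is_iso_cone_endo X Y Z (f : Hom X Y) (g : Hom Y Z) (h : Hom Z (shift X))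
    (e : Hom Z Z) :
  dist f g h -> e \oc g = g -> h \oc e = h -> is_iso e.
Proof.
move=> d eg he; apply: is_iso_unipotent.
have [|u eu] := dist_factor_shift (u := e - idm Z) d.
  by rewrite compBl eg comp_idl subrr.
by rewrite {1}eu -compA compBr he comp_idr subrr comp0r.
Qed.

(** There are fillers in both directions, and both composites are invertible by [is_iso_cone_endo];
    so [c] has a left and a right inverse. *)
Lemma cone_isom X Y Z X' Y' Z' (f : Hom X Y) (g : Hom Y Z)
    (h : Hom Z (shift X)) (f' : Hom X' Y') (g' : Hom Y' Z')
    (h' : Hom Z' (shift X')) (a : Hom X X') (b : Hom Y Y') :
  dist f g h -> dist f' g' h' -> is_iso a -> is_iso b ->
  b \oc f = f' \oc a -> isom Z Z'.
Proof.
move=> d d' [a' [a'a aa']] [b' [b'b bb']] bf.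
have b'f' : b' \oc f' = f \oc a'.
  by rewrite -[f'](comp_idr) -aa' (compA f') -bf !compA b'b comp_idl.
have [c [cg hc]] := dist_mor d d' bf.
have [c' [c'g hc']] := dist_mor d' d b'f'.
have [e [ee _]] : is_iso (c' \oc c).
  apply: (is_iso_cone_endo d).
    by rewrite -compA cg compA c'g -compA b'b comp_idr.
  by rewrite compA -hc' -compA -hc compA -fmap_comp a'a fmap_id comp_idl.
have [e' [_ ee']] : is_iso (c \oc c').
  apply: (is_iso_cone_endo d').
    by rewrite -compA c'g compA cg -compA bb' comp_idr.
  by rewrite compA -hc -compA -hc' compA -fmap_comp aa' fmap_id comp_idl.
exists c; apply: (is_iso_split (g := e \oc c') (g' := c' \oc e')).
  by rewrite -compA.
by rewrite compA.
Qed.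

Definition is_triangle X Y Z : Prop :=
  exists (f : Hom X Y) (g : Hom Y Z) (h : Hom Z (shift X)), dist f g h.

Lemma is_triangle_isom X Y Z X' Y' Z' : isom X X' -> isom Y Y' -> isom Z Z' ->
  is_triangle X Y Z -> is_triangle X' Y' Z'.
Proof.
move=> [a ia] [b ib] [c ic] [f [g [h d]]].
have [a' [a'a aa']] := ia; have [b' [b'b bb']] := ib.
have [c' [c'c cc']] := ic.
exists (b \oc f \oc a'), (c \oc g \oc b'), (fmap shift a \oc h \oc c').
apply: dist_iso ia ib ic _ _ _ d.
- by rewrite -compA a'a comp_idr.
- by rewrite -compA b'b comp_idr.
- by rewrite -compA c'c comp_idr.
Qed.

Lemma is_triangle_isom0 X Y Z : is_zero Z -> isom X Y -> is_triangle X Y Z.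
Proof.
move=> Z0 XY; apply: (is_triangle_isom (isom_refl X) XY (isom_refl Z)).
by exists (idm X), 0, 0; exact: dist_id.
Qed.

Lemma triangle_K0 X Y Z :
  is_triangle X Y Z -> K0_class Y - K0_class X = K0_class Z.
Proof. by move=> [f [g [h]]]; exact: K0_dist. Qed.

(** An isomorphism completes to a triangle with third term a zero object [N], and the identity
    triangle shows that [N] has class 0. *)
Lemma isom_K0 X Y : isom X Y -> K0_class X = K0_class Y.
Proof.
have [[N N0] _] := tri_additive T.
have Ncl : K0_class N = 0.
  by rewrite -(triangle_K0 (is_triangle_isom0 N0 (isom_refl X))) subrr.
move=> /(is_triangle_isom0 N0)/triangle_K0; rewrite Ncl => /eqP.
by rewrite subr_eq0 => /eqP ->.
Qed.

Lemma exact_triangle (F : autoeq T) X Y Z :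
  is_triangle X Y Z -> is_triangle (F X) (F Y) (F Z).
Proof.
have [theta [_ _ Fd]] := aut_exact F.
by move=> [f [g [h /Fd d]]]; do 3 eexists; exact: d.
Qed.

(* A quasi-inverse carries triangles to triangles because cones are unique up
   to isomorphism. *)
Lemma quasi_inverse_triangle (F : autoeq T) (G : functor T T) X Y Z :
  quasi_inverse F G -> is_triangle X Y Z -> is_triangle (G X) (G Y) (G Z).
Proof.
move=> FG [f [g [h d]]].
have [W [g1 [h1 d1]]] := dist_cone (fmap G f).
have [theta [_ _ /(_ _ _ _ _ _ _ d1) d2]] := aut_exact F.
have [_ [eta [eta_iso nat]]] := FG.
have FWZ : isom (F W) Z by apply: cone_isom d2 d (eta_iso X) (eta_iso Y) (nat _ _ f).
apply: (is_triangle_isom (isom_refl _) (isom_refl _)); last first.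
  by exists (fmap G f), g1, h1.
exact: isom_trans (isom_sym (quasi_inverse_isoml FG W)) (functor_isom G FWZ).
Qed.

End Triangles.

(** * Harder-Narasimhan filtrations *)

Section HarderNarasimhan.
Variables (R : realType) (k : fieldType) (T : tricat k).
Implicit Types (P : R -> set (Ob T)) (E A : Ob T) (s : seq (R * Ob T)).

Lemma HN_nil P E : HN_filtration P E [::] -> is_zero E.
Proof. by move=> [Ei [/[swap] <-]]. Qed.

(** Peeling off the factor of smallest phase is the induction step of the uniqueness proof. *)
Lemma HN_rcons P E s phi A : HN_filtration P E (rcons s (phi, A)) ->
  exists E0, [/\ HN_filtration P E0 s, all (fun a => phi < a.1) s,
    ~ is_zero A, P phi A & is_triangle E0 E A].
Proof.
move=> [Ei [Ei0 EiE]].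
rewrite map_rcons (sorted_pairwise (rev_trans lt_trans)) pairwise_rcons all_map /=.
move=> /andP[phis]; rewrite -(sorted_pairwise (rev_trans lt_trans)) => ss.
rewrite size_rcons in EiE * => Etri; exists (Ei (size s)).
split=> //.
- exists Ei; split=> // i i_s; have := Etri i (ltnW i_s).
  by rewrite nth_rcons i_s (set_nth_default (0, Ei (size s))).
- by have := Etri (size s) (leqnn _); rewrite nth_rcons ltnn eqxx => -[].
- by have := Etri (size s) (leqnn _); rewrite nth_rcons ltnn eqxx => -[].
- have := Etri (size s) (leqnn _); rewrite nth_rcons ltnn eqxx EiE => -[_ _].
  by case=> f [g [h d]]; exists f, g, h.
Qed.

Lemma HN_isom P E E' s : isom E E' -> HN_filtration P E s -> HN_filtration P E' s.
Proof.
move=> EE' [Ei [Ei0 EiE ss Etri]].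
(* Only the top of the chain is replaced; when [s] is empty, the top is also the bottom and must
   stay zero. *)
exists (fun i => if i == size s then E' else Ei i); split=> //.
- by case: eqP => // s0; apply: isom_zero Ei0; rewrite s0 EiE.
- by rewrite eqxx.
- move=> i i_s; rewrite (set_nth_default (0, E) _ i_s).
  have [nz PA [f [g [h d]]]] := Etri i i_s; split=> //.
  apply: (is_triangle_isom _ _ (isom_refl _)); last by exists f, g, h.
    by rewrite ltn_eqF //; exact: isom_refl.
  by case: eqP => [->|_]; [rewrite EiE|exact: isom_refl].
Qed.

Lemma HN_single P phi A : ~ is_zero A -> P phi A -> HN_filtration P A [:: (phi, A)].
Proof.
move=> A0 PA; have [[N N0] _] := tri_additive T.
exists (fun i => if i is 0%N then N else A); split=> // -[|//] _ /=.
split=> //; exists 0, (idm A), 0; exact: dist_idr.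
Qed.

Lemma HN_functor P P' (G : functor T T) E s :
  (forall X, is_zero (G X) -> is_zero X) ->
  (forall X Y Z : Ob T, is_triangle X Y Z -> is_triangle (G X) (G Y) (G Z)) ->
  (forall phi A, P phi A -> P' phi (G A)) ->
  HN_filtration P E s -> HN_filtration P' (G E) [seq (a.1, G a.2) | a <- s].
Proof.
move=> G0 Gtri PP' [Ei [Ei0 EiE ss Etri]].
exists (fun i => G (Ei i)); rewrite size_map; split=> //.
- exact: functor_zero.
- by rewrite EiE.
- by rewrite -map_comp.
- move=> i i_s; rewrite (nth_map (0, E)) //=; have [nz PA d] := Etri i i_s.
  split; [by move=> /G0|exact: PP'|].
  by have [f [g [h d']]] := Gtri _ _ _ d; exists f, g, h.
Qed.

Lemma HN_reparam P P' (u : R -> R) E s :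
  {homo u : x y / x < y} -> (forall phi A, P phi A -> P' (u phi) A) ->
  HN_filtration P E s -> HN_filtration P' E [seq (u a.1, a.2) | a <- s].
Proof.
move=> u_incr PP' [Ei [Ei0 EiE ss Etri]]; exists Ei; rewrite size_map; split=> //.
- move: ss; rewrite -map_comp (map_comp u (fun a => a.1)) => ss.
  by apply: homo_sorted ss => x y; exact: u_incr.
- move=> i i_s; rewrite (nth_map (0, E)) //=; have [nz PA d] := Etri i i_s.
  by split=> //; exact: PP'.
Qed.

Section Uniqueness.
Variable P : R -> set (Ob T).
Hypothesis P_shift : forall phi E, P (phi + 1) E ->
  exists2 E', P phi E' & isom E (shift E').
Hypothesis P_hom : forall phi1 phi2 E1 E2, phi2 < phi1 ->
  P phi1 E1 -> P phi2 E2 -> forall f : Hom E1 E2, f = 0.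

(** By induction the map vanishes on [E0], hence factors through the last factor, from which there
    are no maps to a smaller phase. *)
Lemma HN_hom0 E s psi B : HN_filtration P E s -> all (fun a => psi < a.1) s ->
  P psi B -> forall f : Hom E B, f = 0.
Proof.
elim/last_ind: s E => [|s [phi A] IHs] E.
  by move=> /HN_nil E0 _ _ f; exact: zero_homl.
move=> /HN_rcons[E0 [HNE0 _ A0 PA [i [p [h d]]]]]; rewrite all_rcons /=.
move=> /andP[psi_phi psi_s] PB f.
have [c ->] := dist_factor d (IHs _ HNE0 psi_s PB (f \oc i)).
by rewrite (P_hom psi_phi PA PB c) comp0l.
Qed.

(** Write [B] as the shift of an object of phase [psi - 1]; since [shift] is full, the map comes
    from one between the unshifted objects. *)
Lemma HN_hom0_shift E s psi B : HN_filtration P E s ->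
  all (fun a => psi - 1 < a.1) s -> P psi B -> forall f : Hom (shift E) B, f = 0.
Proof.
move=> HNE psi_s; rewrite -(subrK 1 psi) => /P_shift[B' PB' [b [b' [b'b bb']]]] f.
have [g fg] := quasi_inverse_full (shiftK T) (b \oc f).
move: fg; rewrite (HN_hom0 HNE psi_s PB' g) shift_map0 => bf.
by rewrite -(comp_idl f) -b'b -compA -bf comp0r.
Qed.

(** If [phi' < phi], all phases of [E] exceed [phi'], so [E -> A'] is zero. Then the identity of
    [A'] factors through the shift of [E1], whose phases exceed [phi' + 1], and [A'] is zero. *)
Lemma HN_last_le E E1 s s' phi A phi' A' :
  HN_filtration P E (rcons s (phi, A)) ->
  HN_filtration P E1 s' -> all (fun a => phi' < a.1) s' ->
  ~ is_zero A' -> P phi' A' -> is_triangle E1 E A' -> phi <= phi'.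
Proof.
move=> HNE HNE1 phis' A'0 PA' [i [p [h d]]]; rewrite leNgt; apply/negP => lt_phi.
apply: A'0; rewrite /is_zero; have [_ [_ phis _ _ _]] := HN_rcons HNE.
have p0 : p = 0.
  apply: (HN_hom0 (psi := phi') HNE) => //; rewrite all_rcons /= lt_phi /=.
  by apply: sub_all phis => a; exact: lt_trans.
have [|u ->] := dist_factor_shift (u := idm A') d; first by rewrite p0 comp0r.
rewrite (HN_hom0_shift HNE1 _ PA' u) ?comp0l //.
by apply: sub_all phis' => a; apply: le_lt_trans; rewrite gerBl.
Qed.

(** The two triangles are truncations of [E] at the same phase. Vanishing of Hom from [X] to [A']
    and from [X'] to [A] yields comparison maps; the vanishing from the shifts makes them mutually
    inverse. *)
Lemma HN_last_lift phi X E A X' A' s s' :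
  HN_filtration P X s -> all (fun a => phi < a.1) s ->
  HN_filtration P X' s' -> all (fun a => phi < a.1) s' ->
  P phi A -> P phi A' -> is_triangle X E A -> is_triangle X' E A' ->
  isom X X' /\ isom A A'.
Proof.
move=> HNX phis HNX' phis' PA PA' [f [g [h d]]] [f' [g' [h' d']]].
have gt1 (s0 : seq (R * Ob T)) :
    all (fun a => phi < a.1) s0 -> all (fun a => phi - 1 < a.1) s0.
  by apply: sub_all => a; apply: le_lt_trans; rewrite gerBl.
(* Rigidity of both ends of a truncation triangle, in [retr] and [sect]: the difference between [e]
   and the identity passes, up to a shift, through a map from [shift Y] to [B], which is zero. *)
have retr Y B (i : Hom Y E) (p : Hom E B) (q : Hom B (shift Y)) t (e : Hom B B) :
    dist i p q -> HN_filtration P Y t -> all (fun a => phi < a.1) t ->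
    P phi B -> e \oc p = p -> e = idm B.
  move=> dY HNY pt PB ep; apply/eqP; rewrite -subr_eq0; apply/eqP.
  have [|u ->] := dist_factor_shift (u := e - idm B) dY.
    by rewrite compBl ep comp_idl subrr.
  by rewrite (HN_hom0_shift HNY (gt1 _ pt) PB u) comp0l.
have sect Y B (i : Hom Y E) (p : Hom E B) (q : Hom B (shift Y)) t (e : Hom Y Y) :
    dist i p q -> HN_filtration P Y t -> all (fun a => phi < a.1) t ->
    P phi B -> i \oc e = i -> e = idm Y.
  move=> dY HNY pt PB ie; apply/eqP; rewrite -subr_eq0; apply/eqP.
  have [|u eu] := dist_lift_shift (u := e - idm Y) dY.
    by rewrite compBr ie comp_idr subrr.
  apply: (quasi_inverse_faithful (shiftK T)).
  rewrite eu (HN_hom0_shift HNY (gt1 _ pt) PB u) comp0r.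
  by rewrite shift_map0.
split.
  have [c fc] := dist_lift d' (HN_hom0 HNX phis PA' (g' \oc f)).
  have [c' fc'] := dist_lift d (HN_hom0 HNX' phis' PA (g \oc f')).
  exists c, c'; split.
    by apply: sect d HNX phis PA _; rewrite compA -fc' -fc.
  by apply: sect d' HNX' phis' PA' _; rewrite compA -fc -fc'.
have [c gc] := dist_factor d (HN_hom0 HNX phis PA' (g' \oc f)).
have [c' gc'] := dist_factor d' (HN_hom0 HNX' phis' PA (g \oc f')).
exists c, c'; split.
  by apply: retr d HNX phis PA _; rewrite -compA -gc -gc'.
by apply: retr d' HNX' phis' PA' _; rewrite -compA -gc' -gc.
Qed.

(** The factors themselves are unique only up to isomorphism, so they are compared by phase and
    class, which determine the phases and masses entering [dB]. *)
Lemma HN_unique E s s' : HN_filtration P E s -> HN_filtration P E s' ->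
  [seq (a.1, K0_class a.2) | a <- s] = [seq (a.1, K0_class a.2) | a <- s'].
Proof.
(* This excludes an empty filtration against a nonempty one. *)
have nonzero X t phi B : HN_filtration P X (rcons t (phi, B)) -> ~ is_zero X.
  move=> /HN_rcons[X1 [HNX1 phit B0 PB [i [p [h d]]]]] X0; apply: B0; rewrite /is_zero.
  have [|u ->] := dist_factor_shift (u := idm B) d.
    by rewrite (zero_homl p X0) comp0r.
  rewrite (HN_hom0_shift HNX1 _ PB u) ?comp0l //.
  by apply: sub_all phit => a; apply: le_lt_trans; rewrite gerBl.
elim/last_ind: s E s' => [|s [phi A] IHs] E s'.
  move=> /HN_nil E0; case/lastP: s' => [//|s' [phi' A']] /nonzero.
  by move=> /(_ E0).
case/lastP: s' => [/nonzero E0 /HN_nil //|s' [phi' A']] HNE HNE'.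
have [X [HNX phis A0 PA XEA]] := HN_rcons HNE.
have [X' [HNX' phis' A'0 PA' XEA']] := HN_rcons HNE'.
have phiE : phi = phi'.
  apply/le_anti/andP; split.
    exact: HN_last_le HNE HNX' phis' A'0 PA' XEA'.
  exact: HN_last_le HNE' HNX phis A0 PA XEA.
rewrite -phiE in HNE' phis' PA' *.
have [XX' AA'] := HN_last_lift HNX phis HNX' phis' PA PA' XEA XEA'.
by rewrite !map_rcons /= (isom_K0 AA') (IHs _ _ (HN_isom XX' HNX) HNX').
Qed.

End Uniqueness.

End HarderNarasimhan.

(** * Phases and the lift of a stretch of the plane *)

Section ComplexNumbers.
Variable R : realType.
Local Open Scope complex_scope.
Implicit Types (z w : R[i]) (c d phi psi t : R).

Definition same_ray z w : Prop := exists2 c, 0 < c & z = c%:C * w.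

(** The oriented area spanned by [z] and [w]; stretches of determinant 1 preserve it, and its sign
    orders phases less than 1 apart. *)
Definition cross z w : R :=
  complex.Re z * complex.Im w - complex.Im z * complex.Re w.

Lemma complexP z w : complex.Re z = complex.Re w ->
  complex.Im z = complex.Im w -> z = w.
Proof. by case: z w => [a b] [a' b'] /= -> ->. Qed.

Lemma cphaseE phi : cphase phi = cos (pi * phi) +i* sin (pi * phi).
Proof. by rewrite /cphase /cexp /= expR0 mul1r. Qed.

Lemma cexpD z w : cexp (z + w) = cexp z * cexp w.
Proof.
case: z w => [a b] [a' b']; rewrite /cexp /= expRD cosD sinD.
by apply: complexP => /=; ring.
Qed.

Lemma cexp0 : cexp 0 = 1 :> R[i].
Proof. by rewrite /cexp /= expR0 cos0 sin0 mul1r. Qed.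

Lemma cmodM z w : cmod (z * w) = cmod z * cmod w.
Proof. exact: ComplexField.Normc.normcM. Qed.

Lemma cmodE z : cmod z = Num.sqrt (complex.Re z ^+ 2 + complex.Im z ^+ 2).
Proof. by case: z. Qed.

Lemma cmod_ge0 z : 0 <= cmod z.
Proof. by rewrite cmodE sqrtr_ge0. Qed.

Lemma cmodC c : 0 <= c -> cmod c%:C = c.
Proof. by move=> c0; rewrite cmodE /= expr0n addr0 sqrtr_sqr ger0_norm. Qed.

Lemma cmod_cexp z : cmod (cexp z) = expR (complex.Re z).
Proof.
rewrite /cexp cmodM cmodC ?expR_ge0 // cmodE /= cos2Dsin2 sqrtr1 mulr1 //.
Qed.

Lemma cmod_cphase phi : cmod (cphase phi) = 1.
Proof. by rewrite cmod_cexp expR0. Qed.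

Lemma le_cmod z w :
  complex.Re z ^+ 2 + complex.Im z ^+ 2 <= complex.Re w ^+ 2 + complex.Im w ^+ 2 ->
  cmod z <= cmod w.
Proof. by move=> h; rewrite !cmodE ler_wsqrtr. Qed.

(** The moduli give [c = d]. Equal directions have phases differing by an even integer, and the
    bound leaves only 0. *)
Lemma cphase_eq phi psi c d : 0 < c -> 0 < d ->
  c%:C * cphase phi = d%:C * cphase psi -> `|phi - psi| < 2 -> phi = psi.
Proof.
move=> c0 d0 e.
have ecd : c = d.
  have := congr1 (@cmod R) e.
  by rewrite (cmodM c%:C) (cmodM d%:C) !cmod_cphase !mulr1 !cmodC ?ltW.
move: e; rewrite ecd => /(mulfI _) e.
have {e} : cphase phi = cphase psi.
  by apply: e; apply/eqP => -[d00]; rewrite d00 ltxx in d0.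
rewrite !cphaseE => -[ec es] lt2; apply/eqP; rewrite -subr_eq0; apply/eqP.
have pi0 := pi_gt0 R.
(* Inside this interval the sine vanishes only at 1, where the cosine is -1. *)
have sin_cos (x : R) : 0 < x < 2 -> sin (pi * x) = 0 -> cos (pi * x) = 1 -> False.
  move=> /andP[x0 x2] sx cx; have [x1|x1|x1] := ltgtP x 1.
  - have := @sin_gt0_pi R (pi * x); rewrite sx ltxx => h; suff : false by [].
    by apply: h; apply/andP; split; nra.
  - have := @sin_gt0_pi R (pi * x - pi).
    have -> : sin (pi * x - pi) = - sin (pi * x).
      by rewrite -[in RHS](subrK pi (pi * x)) sinDpi opprK.
    rewrite sx oppr0 ltxx => h; suff : false by [].
    by apply: h; apply/andP; split; nra.
  - by move: cx; rewrite x1 mulr1 cospi => h; lra.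
have sd : sin (pi * (phi - psi)) = 0.
  by rewrite mulrBr sinB es ec mulrC subrr.
have cd : cos (pi * (phi - psi)) = 1.
  by rewrite mulrBr cosB es ec -!expr2 cos2Dsin2.
case: (ltgtP (phi - psi) 0) => // h; exfalso.
  apply: (sin_cos (- (phi - psi))).
  - by rewrite oppr_gt0 h -ltr0_norm.
  - by rewrite mulrN sinN sd oppr0.
  - by rewrite mulrN cosN.
by apply: (sin_cos (phi - psi)) => //; rewrite h -(gtr0_norm h).
Qed.

Definition stretch t z : R[i] :=
  (expR t * complex.Re z) +i* (expR (- t) * complex.Im z).

Lemma stretchD t z w : stretch t (z + w) = stretch t z + stretch t w.
Proof. by case: z w => [a b] [a' b']; apply: complexP => /=; ring. Qed.

Lemma stretchZ t c z : stretch t (c%:C * z) = c%:C * stretch t z.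
Proof. by case: z => a b; apply: complexP => /=; ring. Qed.

Lemma stretch_add s t z : stretch s (stretch t z) = stretch (s + t) z.
Proof.
by case: z => a b; apply: complexP => /=; rewrite ?opprD expRD; ring.
Qed.

Lemma stretch0 z : stretch 0 z = z.
Proof. by case: z => a b; rewrite /stretch /= oppr0 expR0 !mul1r. Qed.

Lemma cmod_stretch t z : cmod (stretch t z) <= expR `|t| * cmod z.
Proof.
have -> : expR `|t| * cmod z = cmod ((expR `|t|)%:C * z).
  by rewrite cmodM cmodC // expR_ge0.
have e1 : expR t <= expR `|t| by rewrite ler_expR ler_norm.
have e2 : expR (- t) <= expR `|t| by rewrite ler_expR -normrN ler_norm.
apply: le_cmod; case: z => a b /=.
rewrite !mul0r subr0 addr0 !exprMn; apply: lerD.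
  by apply: ler_wpM2r; rewrite ?sqr_ge0 // lerXn2r // nnegrE expR_ge0.
by apply: ler_wpM2r; rewrite ?sqr_ge0 // lerXn2r // nnegrE expR_ge0.
Qed.

(** The lift to phases of the action of [stretch (- t)] on directions. The quotient is [cross] over
    the scalar product of the unit vector of phase [phi] and its image, i.e. the tangent of the
    angle between them. The scalar product is positive, so the arctangent gives that angle. *)
Definition turn t phi : R :=
  let c := cos (pi * phi) in let s := sin (pi * phi) in
  phi + atan ((expR t - expR (- t)) * (s * c)
              / (expR (- t) * c ^+ 2 + expR t * s ^+ 2)) / pi.

Lemma turn_den t phi :
  0 < expR (- t) * cos (pi * phi) ^+ 2 + expR t * sin (pi * phi) ^+ 2.
Proof.
have e := cos2Dsin2 (pi * phi); have p0 := expR_gt0 t; have q0 := expR_gt0 (- t).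
have := sqr_ge0 (cos (pi * phi)); have := sqr_ge0 (sin (pi * phi)).
move: e; set x := _ ^+ 2; set y := _ ^+ 2 => e y0 x0.
have [x1|x1] := ltP x (2^-1); nra.
Qed.

Lemma turn_compat t phi :
  same_ray (stretch (- t) (cphase phi)) (cphase (turn t phi)).
Proof.
have D0 := turn_den t phi.
have pi0 := pi_gt0 R.
rewrite !cphaseE /turn /= [pi * (phi + _)]mulrDr [pi * (_ / pi)]mulrC divfK ?gt_eqF //.
set c := cos (pi * phi) in D0 *; set s := sin (pi * phi) in D0 *.
have e : s ^+ 2 = 1 - c ^+ 2 by rewrite -(cos2Dsin2 (pi * phi)) addrC addKr.
have pq : expR t * expR (- t) = 1 by rewrite -expRD subrr expR0.
move: D0 pq; set p := expR t; set q := expR (- t).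
set D := (X in 0 < X) => D0 pq; set N := (p - q) * (s * c).
(* This is the secant of the angle of rotation, so [r * D] is the length of the stretched unit
   vector. *)
pose r := Num.sqrt (1 + (N / D) ^+ 2).
have r0 : 0 < r by rewrite sqrtr_gt0 ltr_pwDl // sqr_ge0.
have ca : cos (atan (N / D)) = r^-1 by rewrite cos_atan.
have sa : sin (atan (N / D)) = N / D * r^-1.
  have ca0 : cos (atan (N / D)) != 0 by rewrite ca invr_neq0 // gt_eqF.
  by rewrite -[N / D in RHS]atanK -ca /tan divfK.
exists (r * D); first by rewrite mulr_gt0.
rewrite cosD sinD ca sa -/c -/s /stretch /= opprK -/p -/q.
have r0' : r != 0 by rewrite gt_eqF.
have D0' : D != 0 by rewrite gt_eqF.
apply: complexP => /=.
  rewrite mul0r subr0.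
  have -> : r * D * (c * r^-1 - s * (N / D * r^-1)) = c * D - s * N.
    by field; rewrite r0'.
  rewrite /N /D.
  have -> : c * (q * c ^+ 2 + p * s ^+ 2) - s * ((p - q) * (s * c))
      = q * c * (c ^+ 2 + s ^+ 2) by ring.
  by rewrite e addrC subrK mulr1.
rewrite mul0r addr0.
have -> : r * D * (s * r^-1 + c * (N / D * r^-1)) = c * N + s * D.
  by field; rewrite r0'.
rewrite /N /D.
have -> : c * ((p - q) * (s * c)) + s * (q * c ^+ 2 + p * s ^+ 2)
    = p * s * (c ^+ 2 + s ^+ 2) by ring.
by rewrite e addrC subrK mulr1.
Qed.

Lemma turn_close t phi : `|turn t phi - phi| < 2^-1.
Proof.
have pi0 := pi_gt0 R; rewrite /turn /= [phi + _]addrC addrK.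
set a := (X in atan X).
have := atan_ltpi2 a; have := atan_gtNpi2 a; rewrite ltr_norml => h1 h2.
rewrite ltr_pdivlMr // ltr_pdivrMr //; apply/andP; split; lra.
Qed.

Lemma pi_ge1 : 1 <= pi :> R.
Proof. by have := pi_ge2 R; lra. Qed.

Lemma pi_neq0 : pi != 0 :> R.
Proof. by rewrite gt_eqF // pi_gt0. Qed.

Lemma turn_derive phi t : is_derive t 1 (turn^~ phi)
  (2 * (sin (pi * phi) * cos (pi * phi)) / pi
   / ((expR (- t) * cos (pi * phi)) ^+ 2 + (expR t * sin (pi * phi)) ^+ 2)).
Proof.
have D0 := turn_den t phi.
rewrite /turn /=.
set c := cos (pi * phi) in D0 *; set s := sin (pi * phi) in D0 *.
have e : s ^+ 2 = 1 - c ^+ 2 by rewrite -(cos2Dsin2 (pi * phi)) addrC addKr.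
have pq : expR t * expR (- t) = 1 by rewrite -expRD subrr expR0.
pose num (x : R) := (expR x - expR (- x)) * (s * c).
pose den (x : R) := expR (- x) * c ^+ 2 + expR x * s ^+ 2.
have dnum : is_derive t 1 num ((expR t + expR (- t)) * (s * c)).
  rewrite /num; apply: is_derive_eq; rewrite /=.
  by rewrite /GRing.scale /=; ring.
have dden : is_derive t 1 den (- expR (- t) * c ^+ 2 + expR t * s ^+ 2).
  rewrite /den; apply: is_derive_eq; rewrite /=.
  by rewrite /GRing.scale /=; ring.
have D0' : den t != 0 by rewrite gt_eqF.
have dquo := is_deriveM dnum (is_deriveV D0' dden).
have dall := is_deriveD (is_derive_cst phi t 1) (is_deriveM
  (@is_derive1_comp R atan (num * (fun y => (den y)^-1)) t _ _ (is_derive1_atan _) dquo)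
  (is_derive_cst pi^-1 t 1)).
apply: (is_derive_eq dall).
rewrite /GRing.scale /= mulr0 add0r add0r -[(num * _) t]/(num t * (den t)^-1).
have K0 : den t ^+ 2 + num t ^+ 2 != 0.
  by rewrite gt_eqF // ltr_pwDl ?sqr_ge0 // exprn_gt0.
(* Lagrange's identity for the unit vector and its image: the squares of scalar product and area add
   up to the squared length of the image. *)
have K : den t ^+ 2 + num t ^+ 2 = (expR (- t) * c) ^+ 2 + (expR t * s) ^+ 2.
  rewrite /den /num; move: (expR t) (expR (- t)) pq => p q pq.
  transitivity ((s ^+ 2 + c ^+ 2) * ((q * c) ^+ 2 + (p * s) ^+ 2));
    last by rewrite e subrK mul1r.
  ring.
have J : (expR t + expR (- t)) * (s * c) * den t
    - num t * (- expR (- t) * c ^+ 2 + expR t * s ^+ 2) = 2 * (s * c).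
  rewrite /den /num; move: (expR t) (expR (- t)) pq => p q pq.
  transitivity (2 * (s * c) * (p * q) * (s ^+ 2 + c ^+ 2));
    last by rewrite e subrK pq !mulr1.
  ring.
rewrite -K -J; move: (pi_neq0); move: (@pi R) => q q0.
by field; rewrite K0 D0' q0.
Qed.

(** By the mean value theorem it suffices to bound the derivative by 1. With [a] and [b] the
    coordinates of the stretched vector, it is [2 a b / (a^2 + b^2)] divided by [pi]. *)
Lemma turn_lip s t phi : `|turn s phi - turn t phi| <= `|s - t|.
Proof.
wlog ts : s t / t <= s.
  by move=> h; have [/h//|/ltW/h] := leP t s; rewrite distrC [in X in _ <= X]distrC.
have [|x _ ->] := @MVT_segment R (turn^~ phi) _ t s ts (fun x _ => turn_derive phi x).
  by apply: derivable_within_continuous => x _; have [] := turn_derive phi x.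
rewrite normrM ler_piMl //.
have := turn_den x phi.
set c := cos (pi * phi); set y := sin (pi * phi) => D0.
have pq : expR x * expR (- x) = 1 by rewrite -expRD subrr expR0.
have K0 : 0 < (expR (- x) * c) ^+ 2 + (expR x * y) ^+ 2.
  rewrite lt_neqAle eq_sym addr_ge0 ?sqr_ge0 // andbT paddr_eq0 ?sqr_ge0 //.
  rewrite !sqrf_eq0 !mulf_eq0 !(gt_eqF (expR_gt0 _)) /=.
  apply/negP => /andP[/eqP c0 /eqP y0].
  by move: D0; rewrite c0 y0 expr0n /= !mulr0 addr0 ltxx.
rewrite normrM normfV (gtr0_norm K0) ler_pdivrMr // mul1r normrM normfV.
rewrite (ger0_norm (pi_ge0 R)).
apply: (@le_trans _ _ `|2 * (y * c)|).
  by rewrite ler_pdivrMr ?pi_gt0 // ler_peMr // pi_ge1.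
have -> : 2 * (y * c) = 2 * ((expR x * y) * (expR (- x) * c)).
  by rewrite mulrACA pq mul1r.
move: (expR x * y) (expR (- x) * c) => a b.
rewrite ler_norml; apply/andP; split; rewrite -subr_ge0.
  by have := sqr_ge0 (a + b); rewrite sqrrD; lra.
by have := sqr_ge0 (a - b); rewrite sqrrB; lra.
Qed.

Lemma crossZ c d z w : cross (c%:C * z) (d%:C * w) = c * d * cross z w.
Proof. by case: z w => [a b] [a' b']; rewrite /cross /=; ring. Qed.

Lemma cross_stretch t z w : cross (stretch t z) (stretch t w) = cross z w.
Proof.
have pq : expR t * expR (- t) = 1 by rewrite -expRD subrr expR0.
case: z w => [a b] [a' b']; rewrite /cross /=.
by rewrite mulrACA pq mul1r [expR (- t) * b * _]mulrACA [expR (- t) * _]mulrC pq mul1r.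
Qed.

Lemma cross_cphase phi psi : cross (cphase phi) (cphase psi) = sin (pi * (psi - phi)).
Proof. by rewrite !cphaseE /cross /= mulrBr sinB; ring. Qed.

(** If the phases are at least 1 apart, [turn_close] suffices. Otherwise the sine of their
    difference is positive, and [stretch] keeps its sign by preserving [cross]; [turn_close]
    excludes a wrap-around. *)
Lemma turn_incr t : {homo turn t : phi psi / phi < psi}.
Proof.
move=> phi psi lt; have pi0 := pi_gt0 R.
have := turn_close t phi; have := turn_close t psi; rewrite !ltr_norml.
move=> /andP[h1 h2] /andP[h3 h4].
have [ge1|lt1] := leP 1 (psi - phi); first lra.
have [c c0 ec] := turn_compat t phi; have [d d0 ed] := turn_compat t psi.
have := cross_stretch (- t) (cphase phi) (cphase psi).
rewrite ec ed crossZ !cross_cphase => es.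
have s0 : 0 < sin (pi * (psi - phi)) by apply: sin_gt0_pi; apply/andP; split; nra.
have st : 0 < sin (pi * (turn t psi - turn t phi)).
  by rewrite -(pmulr_rgt0 _ (mulr_gt0 c0 d0)) es.
rewrite -subr_gt0 ltNge; apply/negP => le0.
suff : 0 <= sin (- (pi * (turn t psi - turn t phi))) by rewrite sinN; lra.
by apply: sin_ge0_pi; apply/andP; split; nra.
Qed.

Lemma turn_period t phi : turn t (phi + 1) = turn t phi + 1.
Proof.
by rewrite /turn mulrDr mulr1 cosDpi sinDpi !sqrrN mulrNN addrAC.
Qed.

(** Both sides are phases of the same vector, and three uses of [turn_close] put them within 3/2 of
    each other, below the period 2. *)
Lemma turn_comp s t phi : turn s (turn t phi) = turn (s + t) phi.
Proof.
have [c c0 ec] := turn_compat t phi.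
have [d d0 ed] := turn_compat s (turn t phi).
have [e e0 ee] := turn_compat (s + t) phi.
apply: (cphase_eq (c := c * d) (d := e)) => //; first by rewrite mulr_gt0.
  rewrite -ee opprD -stretch_add ec stretchZ ed.
  have -> : (c * d)%:C = c%:C * d%:C by exact: rmorphM.
  exact: esym (mulrA _ _ _).
have := turn_close s (turn t phi); have := turn_close t phi.
have := turn_close (s + t) phi; rewrite !ltr_norml.
by move=> /andP[h1 h2] /andP[h3 h4] /andP[h5 h6]; apply/andP; split; lra.
Qed.

Lemma turn0 phi : turn 0 phi = phi.
Proof. by rewrite /turn oppr0 subrr mul0r mul0r atan0 mul0r addr0. Qed.

(** The difference [n] of the two lifts always points in the direction of [e], so it takes values in
    a coset of the even integers. Continuity of [f] is replaced by monotonicity and periodicity: on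
    phases less than 1 apart [n] varies by at most 1, hence not at all. *)
Lemma turn_shift_const t (f : R -> R) (e : R[i]) :
  {homo f : phi psi / phi < psi} -> (forall phi, f (phi + 1) = f phi + 1) ->
  (forall phi, same_ray (e * cphase (turn t phi)) (cphase (f phi))) ->
  exists n, forall phi, f phi = turn t phi + n.
Proof.
move=> f_incr f_period fe; pose n phi := f phi - turn t phi.
have fray phi : same_ray e (cphase (n phi)).
  have [c c0 ec] := fe phi; exists c => //.
  move/(congr1 (fun z => z * cphase (- turn t phi))): ec.
  have cK : cphase (turn t phi) * cphase (- turn t phi) = 1.
    rewrite /cphase -cexpD -cexp0; congr cexp.
    by apply: complexP => /=; rewrite ?addr0 // mulrN subrr.
  rewrite -(mulrA e) cK mulr1 => ->; rewrite -(mulrA c%:C); congr (_ * _).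
  rewrite /cphase -cexpD; congr cexp.
  by apply: complexP => /=; rewrite ?addr0 // /n mulrBr mulrN.
have n_local phi psi : `|phi - psi| < 1 -> n phi = n psi.
  move=> close; have [c c0 ec] := fray phi; have [d d0 ed] := fray psi.
  apply: (cphase_eq c0 d0); first by rewrite -ec -ed.
  wlog le : phi psi {c c0 ec d d0 ed} close / phi <= psi.
    move=> h; have [/h|/ltW/h] := leP phi psi; first exact.
    by rewrite distrC [in X in _ -> X]distrC; exact.
  have : `|n phi - n psi| <= 1; last by lra.
  have [->|lt] := eqVneq phi psi; first by rewrite subrr normr0.
  have {lt}lt : phi < psi by rewrite lt_neqAle lt.
  have lt1 : psi < phi + 1 by move: close; rewrite distrC ltr_norml; lra.
  have := f_incr _ _ lt; have := f_incr _ _ lt1; rewrite f_period.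
  have := turn_incr t lt; have := turn_incr t lt1; rewrite turn_period /n.
  by rewrite ler_norml => *; apply/andP; split; lra.
exists (n 0) => phi; rewrite -[n 0](_ : n phi = _); first by rewrite /n addrC subrK.
(* Walk from 0 to [phi] in [m.+1] equal steps of length less than 1. *)
have [m phim] : exists m : nat, `|phi| < m.+1%:R.
  by exists (Num.truncn `|phi|); exact: truncnS_gt.
have step i : n (phi / m.+1%:R * i%:R) = n 0.
  elim: i => [|i <-]; first by rewrite mulr0.
  apply: n_local; rewrite -mulrBr -[i.+1]addn1 natrD addrC addKr mulr1.
  by rewrite normrM normfV normr_nat ltr_pdivrMr ?ltr0n // mul1r.
by rewrite -(step m.+1) divfK // pnatr_eq0.
Qed.

Lemma mx_act_diag2 (a b : R) z :
  mx_act (diag2 a b) z = (a * complex.Re z) +i* (b * complex.Im z).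
Proof. by apply: complexP; rewrite /= !mxE /= mul0r ?addr0 ?add0r. Qed.

Lemma invmx_diag2 (a b : R) : a * b = 1 -> invmx (diag2 a b) = diag2 b a.
Proof.
move=> ab; have e : diag2 a b *m diag2 b a = 1%:M.
  apply/matrixP => i j; rewrite !mxE !big_ord_recl big_ord0 !mxE /=.
  case: i => -[|[|//]] ?; case: j => -[|[|//]] ? /=;
    by rewrite ?mul0r ?mulr0 ?addr0 ?add0r ?ab // mulrC.
have u : diag2 a b \in unitmx by have [] := mulmx1_unit e.
by rewrite -[RHS]mul1mx -(mulVmx u) -mulmxA e mulmx1.
Qed.

(** Here and below, [sin (pi * n) = 0] expresses that the real number [n] is an integer; then
    [cos (pi * n)] is its parity sign. *)
Lemma cexp_integer (n : R) : sin (pi * n) = 0 ->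
  cexp (- ((0 +i* pi) * n%:C)) = (cos (pi * n))%:C.
Proof.
move=> sn; have -> : - ((0 +i* pi) * n%:C) = 0 +i* (- (pi * n)).
  by apply: complexP => /=; ring.
by rewrite /cexp /= expR0 mul1r cosN sinN sn oppr0.
Qed.

Lemma turn_integer t (n : R) phi : sin (pi * n) = 0 ->
  turn t (phi + n) = turn t phi + n.
Proof.
move=> sn; have c1 : cos (pi * n) * cos (pi * n) = 1.
  by have := cos2Dsin2 (pi * n); rewrite sn expr0n addr0 expr2.
rewrite /turn mulrDr cosD sinD sn !mulr0 subr0 addr0 !exprMn -!expr2 in c1 *.
by rewrite mulrACA -expr2 c1 !mulr1 addrAC.
Qed.

(** The sign of [r] and the choice of the lift amount to a number of half turns, i.e. to the action
    of an integer [n] in C; what remains is a stretch with positive entries. *)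
Lemma GLtilde_turn (g : GLtilde R) (r : R) : 1 < `|r| ->
  gl_mx g = diag2 r^-1 r \/ gl_mx g = diag2 r r^-1 ->
  exists t n, [/\ `|t| = ln `|r|, sin (pi * n) = 0,
    forall phi, gl_fun g phi = turn t phi + n & forall z,
    mx_act (invmx (gl_mx g)) z = cexp (- ((0 +i* pi) * n%:C)) * stretch t z].
Proof.
move=> r1 gmx; have r0 : 0 < `|r| by lra.
have rn0 : r != 0 by rewrite -normr_gt0.
(* The two shapes of the matrix differ by the sign of [t]. The minus sign in the exponent arises
   because the inverse matrix acts on central charges. *)
have [a [t [ae gE tr]]] : exists a t, [/\ `|a| = expR (- t), gl_mx g = diag2 a a^-1
    & `|t| = ln `|r|].
  have lr : 0 < ln `|r| by rewrite ln_gt0.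
  case: gmx => ->.
    exists r^-1, (ln `|r|); rewrite invrK (gtr0_norm lr); split=> //.
    by rewrite expRN lnK // normfV.
  exists r, (- ln `|r|); rewrite normrN (gtr0_norm lr); split=> //.
  by rewrite opprK lnK.
have a0 : a != 0 by rewrite -normr_gt0 ae expR_gt0.
pose e := Num.sg a.
have aE : a = e * expR (- t) by rewrite -ae /e -numEsg.
have eV : e^-1 = e by rewrite /e; case: sgrP a0; rewrite ?eqxx // ?invr1 ?invrN ?invr1.
have e0 : e != 0 by rewrite sgr_eq0.
have aV : a^-1 = e * expR t by rewrite aE invfM eV -expRN opprK.
have actg z : mx_act (gl_mx g) z = e%:C * stretch (- t) z.
  rewrite gE mx_act_diag2; case: z => x y; apply: complexP => /=.
    by rewrite aE; ring.
  by rewrite aV opprK; ring.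
have actV z : mx_act (invmx (gl_mx g)) z = e%:C * stretch t z.
  rewrite gE invmx_diag2 ?divff // mx_act_diag2; case: z => x y; apply: complexP => /=.
    by rewrite aV; ring.
  by rewrite aE; ring.
have ray phi : same_ray (e%:C * cphase (turn t phi)) (cphase (gl_fun g phi)).
  have [c c0 ec] := turn_compat t phi; have [d d0 ed] := gl_compat g phi.
  exists (c^-1 * d); first by rewrite mulr_gt0 // invr_gt0.
  move: ed; rewrite actg ec mulrCA => ed.
  have -> : (c^-1 * d)%:C = (c^-1)%:C * d%:C by exact: rmorphM.
  rewrite -(mulrA _ d%:C) -ed (mulrA (c^-1)%:C).
  have -> : (c^-1)%:C * c%:C = 1 by rewrite -rmorphM /= mulVf ?gt_eqF.
  by rewrite mul1r.
have [n nE] := turn_shift_const (@gl_incr _ g) (@gl_period _ g) ray.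
(* At the phase [turn (- t) 0] the ray condition compares the sign [e] with the direction of [n]:
   this gives integrality of [n] and [e = cos (pi * n)]. *)
have tt : turn t (turn (- t) 0) = 0 by rewrite turn_comp subrr turn0.
have := ray (turn (- t) 0); rewrite nE tt add0r => -[c c0].
have c1 : cphase 0 = 1 :> R[i] by rewrite cphaseE mulr0 cos0 sin0.
rewrite c1 mulr1 => ec.
have {c0} cE : c = 1.
  have := congr1 (@cmod R) ec.
  rewrite (cmodM c%:C) cmod_cphase mulr1 (cmodC (ltW c0)) => <-.
  by rewrite cmodE /= expr0n addr0 sqrtr_sqr normr_sg a0.
move: ec; rewrite cE mul1r cphaseE => -[en sn].
by exists t, n; split=> // z; rewrite actV cexp_integer -?sn // en.
Qed.

Lemma cmod_le_abs z : cmod z <= `|complex.Re z| + `|complex.Im z|.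
Proof.
have h : 0 <= `|complex.Re z| + `|complex.Im z| by rewrite addr_ge0.
rewrite cmodE -(ger0_norm h) -sqrtr_sqr ler_wsqrtr // sqrrD !real_normK ?num_real //.
by rewrite addrAC lerDl mulrn_wge0 // mulr_ge0.
Qed.

(** Near one axis the length is multiplied by almost [kappa * expR |t|], near the other by almost
    [kappa * expR (- |t|)]. Both factors lie between [1 / D] and [D], so their quotient is at most
    [D ^+ 2] and [kappa] cancels. *)
Lemma stretch_limit t (kappa D : R) : 0 < kappa ->
  (forall delta, 0 < delta -> exists z, [/\ complex.Re z != 0,
     `|complex.Im z| <= delta * `|complex.Re z|,
     cmod z <= D * (kappa * cmod (stretch t z)) &
     kappa * cmod (stretch t z) <= D * cmod z]) ->
  (forall delta, 0 < delta -> exists z, [/\ complex.Im z != 0,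
     `|complex.Re z| <= delta * `|complex.Im z|,
     cmod z <= D * (kappa * cmod (stretch t z)) &
     kappa * cmod (stretch t z) <= D * cmod z]) ->
  expR `|t| <= D.
Proof.
move=> k0 H1 H2.
(* The passage to the limit, with [p] the expanding and [q] the contracting factor. *)
have aux (p q : R) : 0 < p -> p * q = 1 ->
    (forall delta, 0 < delta -> kappa * p <= D * (1 + delta)) ->
    (forall delta, 0 < delta -> 1 <= D * (kappa * (p * delta + q))) -> p <= D.
  move=> p0 pq h1 h2.
  have kp := mulr_gt0 k0 p0.
  have D0 : 0 < D by have := h1 1 ltr01; lra.
  have h1' : kappa * p <= D.
    apply/ler_addgt0Pr => e e0; have := h1 (e / D) (divr_gt0 e0 D0).
    by rewrite mulrDr mulr1 [D * _]mulrC divfK ?gt_eqF.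
  have h2' : 1 <= D * (kappa * q).
    apply/ler_addgt0Pr => e e0.
    have Dk0 : 0 < D * (kappa * p) by rewrite !mulr_gt0.
    have := h2 _ (divr_gt0 e0 Dk0).
    suff -> : D * (kappa * (p * (e / (D * (kappa * p))) + q))
      = D * (kappa * q) + e by [].
    by field; rewrite !gt_eqF.
  have h3 : p <= D * kappa.
    have := ler_wpM2r (ltW p0) h2'; rewrite mul1r.
    have -> : D * (kappa * q) * p = D * kappa * (p * q) by ring.
    by rewrite pq mulr1.
  have : p ^+ 2 <= D ^+ 2.
    rewrite -(ler_pM2l k0) !expr2 mulrA; nra.
  by rewrite ler_sqr // nnegrE ltW.
have cmod_re z : `|complex.Re z| <= cmod z.
  by rewrite cmodE -sqrtr_sqr ler_wsqrtr // lerDl sqr_ge0.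
have cmod_im z : `|complex.Im z| <= cmod z.
  by rewrite cmodE -sqrtr_sqr ler_wsqrtr // lerDr sqr_ge0.
have pq : expR t * expR (- t) = 1 by rewrite -expRD subrr expR0.
have stretch_re z : complex.Re (stretch t z) = expR t * complex.Re z by [].
have stretch_im z : complex.Im (stretch t z) = expR (- t) * complex.Im z by [].
have D0 : 0 <= D.
  have [z [re0 _ h1 h2]] := H1 1 ltr01.
  have z0 : 0 < cmod z by apply: lt_le_trans (cmod_re z); rewrite normr_gt0.
  rewrite -(pmulr_lge0 _ z0); apply: le_trans h2.
  by rewrite mulr_ge0 ?cmod_ge0 // ltW.
(* In [big] and [small], [x] is the dominant coordinate, expanded by [p] in the former and
   contracted by [q] in the latter; [c] and [cs] are the lengths before and after stretching. *)
have big (p x y c cs delta : R) : 0 < p -> 0 < x -> y <= delta * x ->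
    p * x <= cs -> c <= x + y -> kappa * cs <= D * c -> kappa * p <= D * (1 + delta).
  move=> p0 x0 yx pcs cxy h; rewrite -(ler_pM2r x0) -mulrA.
  apply: le_trans (ler_wpM2l (ltW k0) pcs) _; apply: le_trans h _.
  rewrite -mulrA ler_wpM2l //; lra.
have small (p q x y c cs delta : R) : 0 < p -> 0 < q -> 0 < x -> y <= delta * x ->
    cs <= p * y + q * x -> x <= c -> c <= D * (kappa * cs) ->
    1 <= D * (kappa * (p * delta + q)).
  move=> p0 q0 x0 yx hcs xc h; rewrite -(ler_pM2r x0) mul1r.
  apply: le_trans xc _; apply: le_trans h _.
  rewrite -!mulrA ler_wpM2l // ler_wpM2l ?(ltW k0) //; apply: le_trans hcs _; nra.
have stretch_le z : cmod (stretch t z) <=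
    expR t * `|complex.Re z| + expR (- t) * `|complex.Im z|.
  apply: le_trans (cmod_le_abs _) _.
  by rewrite stretch_re stretch_im !normrM !(ger0_norm (expR_ge0 _)).
have p0 := expR_gt0 t; have q0 := expR_gt0 (- t).
have [t0|t0] := leP 0 t.
  rewrite ger0_norm //; apply: (aux _ _ p0 pq) => delta d0.
    have [z [re0 im h1 h2]] := H1 _ d0; rewrite -normr_gt0 in re0.
    apply: (big _ _ _ _ _ _ p0 re0 im _ (cmod_le_abs z) h2).
    have := cmod_re (stretch t z).
    by rewrite stretch_re normrM (ger0_norm (expR_ge0 _)).
  have [z [re0 im h1 h2]] := H2 _ d0; rewrite -normr_gt0 in re0.
  exact: (small _ _ _ _ _ _ _ p0 q0 re0 im (stretch_le z) (cmod_im z) h1).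
rewrite ltr0_norm //; apply: (aux _ (expR t) q0); first by rewrite mulrC.
  move=> delta d0; have [z [re0 im h1 h2]] := H2 _ d0; rewrite -normr_gt0 in re0.
  have cle := cmod_le_abs z; rewrite addrC in cle.
  apply: (big _ _ _ _ _ _ q0 re0 im _ cle h2).
  by have := cmod_im (stretch t z); rewrite stretch_im normrM (ger0_norm (expR_ge0 _)).
move=> delta d0; have [z [re0 im h1 h2]] := H1 _ d0; rewrite -normr_gt0 in re0.
have sle := stretch_le z; rewrite addrC in sle.
exact: (small _ _ _ _ _ _ _ q0 p0 re0 im sle (cmod_re z) h1).
Qed.

End ComplexNumbers.

(** * Lattices in normed spaces *)

Section ScalarExtensions.
Variables (R : realType) (L : zmodType) (V : normedModType R).
Variable iota : {additive L -> V}.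
Hypothesis iotaP : is_scalar_extension iota.

Lemma mx_entry_le_norm m n (A : 'M[R]_(m, n)) i j : `|A i j| <= `|A|.
Proof.
rewrite [leRHS]/Num.norm /= mx_normrE; apply/bigmax_geP; right => /=.
by exists (i, j).
Qed.

(** The norm attains a minimum on the compact unit sphere of coordinates, and uniqueness of
    coordinates makes it positive; scaling extends the bound to all vectors. *)
Lemma basis_norm_lower n (e : 'I_n -> V) :
  (forall y : V, exists! c : {ffun 'I_n -> R}, y = \sum_i c i *: e i) ->
  exists2 m : R, 0 < m & forall (c : 'I_n -> R) i, m * `|c i| <= `|\sum_j c j *: e j|.
Proof.
move=> e_basis; pose f (c : 'rV[R]_n) : V := \sum_i c 0 i *: e i.
pose S := [set c : 'rV[R]_n | `|c| = 1].
have f_cont : continuous f.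
  apply: (@continuous_big V _ +%R 0 xpredT add_continuous) => i _ c.
  by apply: cvgZr_tmp; [exact: (nbhs_filter c)|exact: (@coord_continuous R 1 n 0 i c)].
have fZ a c : f (a *: c) = a *: f c.
  by rewrite /f scaler_sumr; apply: eq_bigr => i _; rewrite mxE scalerA.
have normalize (c : 'rV[R]_n) : c != 0 -> S (`|c|^-1 *: c).
  by move=> c0; rewrite /S /= normrZ normfV normr_id mulVf // normr_eq0.
(* If the sphere is empty, every coordinate vector is zero and any constant will do. *)
have [[c0 c0S]|S0] := pselect (S !=set0); last first.
  exists 1 => // c i.
  have -> : c i = (\row_j c j) 0 i by rewrite mxE.
  have -> : \row_j c j = 0.
    by apply/eqP/negPn/negP => /normalize h; apply: S0; eexists; exact: h.
  by rewrite mxE normr0 mulr0.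
have S_compact : compact S.
  apply: bounded_closed_compact.
    by exists 1; split; [exact: num_real|move=> x x1 c; rewrite /S /= => ->; exact: ltW].
  have -> : S = (fun c : 'rV[R]_n => `|c|) @^-1` [set 1] by [].
  by apply: preimage_closed; [move=> c _; exact: norm_continuous|exact: closed_eq].
have [||c1 c1S c1_min] := compact_EVT_min (f := fun c => `|f c|) _ S_compact.
- by exists c0.
- apply: continuous_subspaceT => c.
  by apply: continuous_comp; [exact: f_cont|exact: norm_continuous].
rewrite inE in c1S.
have m0 : 0 < `|f c1|.
  rewrite normr_gt0; apply/eqP => fc1.
  have [z [_ z_uniq]] := e_basis 0.
  have z0 : z = [ffun=> 0].
    by apply: z_uniq; rewrite big1 // => i _; rewrite ffunE scale0r.
  have zc : z = [ffun i => c1 0 i].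
    by apply: z_uniq; rewrite -[LHS]fc1 /f; apply: eq_bigr => i _; rewrite ffunE.
  have c10 : c1 = 0.
    apply/rowP => i; rewrite mxE; have := congr1 (fun g : {ffun 'I_n -> R} => g i) zc.
    by rewrite z0 !ffunE.
  by move: c1S; rewrite /S /= c10 normr0 => /esym/eqP; rewrite oner_eq0.
exists `|f c1| => // c i.
have -> : \sum_j c j *: e j = f (\row_j c j).
  by rewrite /f; apply: eq_bigr => j _; rewrite mxE.
have := mx_entry_le_norm (\row_j c j) 0 i; rewrite mxE.
move: (\row_j c j) => d ci; apply: (le_trans (ler_wpM2l (ltW m0) ci)).
have [->|d0] := eqVneq d 0; first by rewrite normr0 mulr0.
have := c1_min _ (mem_set (normalize d d0)).
by rewrite fZ normrZ normfV normr_id -ler_pdivrMl ?invrK ?invr_gt0 ?normr_gt0 // mulrC.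
Qed.

Lemma scalar_extension_sum (A : {additive L -> L}) n (b : 'I_n -> L)
    (c : 'I_n -> int) :
  iota (A (\sum_i b i *~ c i)) = \sum_i (c i)%:~R *: iota (A (b i)).
Proof.
rewrite !raddf_sum; apply: eq_bigr => i _.
by rewrite !raddfMz scaler_int.
Qed.

Lemma scalar_extension_bounded (A : {additive L -> L}) :
  exists2 K : R, 0 < K & forall x, `|iota (A x)| <= K * `|iota x|.
Proof.
have [n [b [b_basis e_basis]]] := iotaP.
have [m m0 m_low] := basis_norm_lower e_basis.
have S0 : 0 <= \sum_i `|iota (A (b i))| by exact: sumr_ge0.
(* The summand 1 only makes the constant positive. *)
exists (\sum_i `|iota (A (b i))| / m + 1).
  by rewrite ltr_wpDl // sumr_ge0 // => i _; rewrite divr_ge0 // ltW.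
move=> x; have [c [-> _]] := b_basis x.
have -> := scalar_extension_sum A b c; have -> := scalar_extension_sum idfun b c.
rewrite /= mulrDl mul1r ler_wpDr //; apply: le_trans (ler_norm_sum _ _ _) _.
rewrite mulr_suml; apply: ler_sum => i _; rewrite normrZ.
rewrite (mulrAC _ m^-1) -mulrA mulrC ler_wpM2l //.
rewrite ler_pdivlMr // mulrC; exact: m_low (fun j => (c j)%:~R) i.
Qed.

(** With [m] from [basis_norm_lower], a vector of norm below [m] has integer coordinates of absolute
    value below 1. *)
Lemma scalar_extension_discrete :
  exists2 m : R, 0 < m & forall x, `|iota x| < m -> x = 0.
Proof.
have [n [b [b_basis e_basis]]] := iotaP.
have [m m0 m_low] := basis_norm_lower e_basis.
exists m => // x; have [c [-> _]] := b_basis x.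
have -> := scalar_extension_sum idfun b c; rewrite /= => lt_m.
apply: big1 => i _; have := le_lt_trans (m_low (fun j => (c j)%:~R) i) lt_m.
rewrite -[ltRHS]mulr1 ltr_pM2l // -intr_norm -[1]/(1%:~R) ltr_int.
by case: (c i) => -[|k] //; rewrite mulr0z.
Qed.

End ScalarExtensions.

(** * Invariants of stability conditions and the generalized metric *)

Section Invariants.
Variables (R : realType) (k : fieldType) (T : tricat k) (L : zmodType).
Variables (V : normedModType R) (iota : {additive L -> V}).
Variable v : {additive K0 T -> L}.
Local Open Scope complex_scope.
Implicit Types (E A : Ob T) (s : seq (R * Ob T)).

Lemma isom_vcl E E' : isom E E' -> vcl v E = vcl v E'.
Proof. by move=> /isom_K0 e; rewrite /vcl e. Qed.

Section Accessors.
Variable sigma : prestab R T L.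
Hypothesis sigmaP : is_stability iota v sigma.

Lemma stability_addC : {morph sigma.1 : x y / x + y}.
Proof. by case: sigma sigmaP => Z P [[]]. Qed.

Lemma stability_additive phi : additive_subcategory (sigma.2 phi).
Proof. by case: sigma sigmaP => Z P [[]]. Qed.

Lemma stability_isom phi E E' : isom E E' -> sigma.2 phi E -> sigma.2 phi E'.
Proof. by have [_ _] := stability_additive phi; apply. Qed.

Lemma stability_phase phi E : ~ is_zero E -> sigma.2 phi E ->
  exists2 c : R, 0 < c & sigma.1 (vcl v E) = c%:C * cphase phi.
Proof. by case: sigma sigmaP => Z P [_ h _ _ _]; exact: h. Qed.

Lemma stability_shift phi E : sigma.2 (phi + 1) E <->
  exists2 E', sigma.2 phi E' & isom E (shift E').
Proof. by case: sigma sigmaP => Z P [_ _ h _ _]; exact: h. Qed.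

Lemma stability_hom phi1 phi2 E1 E2 : phi2 < phi1 ->
  sigma.2 phi1 E1 -> sigma.2 phi2 E2 -> forall f : Hom E1 E2, f = 0.
Proof. by case: sigma sigmaP => Z P [_ _ _ h _]; exact: h. Qed.

Lemma stability_HN E : ~ is_zero E -> exists s, HN_filtration sigma.2 E s.
Proof. by case: sigma sigmaP => Z P [_ _ _ _ [h _]]; exact: h. Qed.

Lemma stability_support : exists2 C : R, 0 < C & forall phi E,
  ~ is_zero E -> sigma.2 phi E -> `|iota (vcl v E)| < C * cmod (sigma.1 (vcl v E)).
Proof. by case: sigma sigmaP => Z P [_ _ _ _ [_ h]]; exact: h. Qed.

Lemma HN_P E : ~ is_zero E -> HN_filtration sigma.2 E (HN sigma E).
Proof. by move=> /stability_HN h; exact: (xgetPex [::] h). Qed.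

(** [HN] is an arbitrary choice; by uniqueness the invariants can be computed from any filtration at
    hand. *)
Lemma HN_classes E s : ~ is_zero E -> HN_filtration sigma.2 E s ->
  [seq (a.1, K0_class a.2) | a <- HN sigma E] = [seq (a.1, K0_class a.2) | a <- s].
Proof.
move=> E0 HNs; apply: HN_unique (HN_P E0) HNs.
  by move=> phi X /stability_shift.
exact: stability_hom.
Qed.

Lemma phases_HN E s : ~ is_zero E -> HN_filtration sigma.2 E s ->
  [seq a.1 | a <- HN sigma E] = [seq a.1 | a <- s].
Proof.
by move=> E0 /(HN_classes E0)/(congr1 (map fst)); rewrite -!map_comp.
Qed.

Lemma phi_plusE E s : ~ is_zero E -> HN_filtration sigma.2 E s ->
  phi_plus sigma E = head 0 [seq a.1 | a <- s].
Proof. by move=> E0 /(phases_HN E0); rewrite /phi_plus => ->. Qed.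

Lemma phi_minusE E s : ~ is_zero E -> HN_filtration sigma.2 E s ->
  phi_minus sigma E = last 0 [seq a.1 | a <- s].
Proof. by move=> E0 /(phases_HN E0); rewrite /phi_minus => ->. Qed.

Lemma sum_vcl_HN (g : L -> R) E s : ~ is_zero E -> HN_filtration sigma.2 E s ->
  \sum_(a <- HN sigma E) g (vcl v a.2) = \sum_(a <- s) g (vcl v a.2).
Proof.
move=> E0 /(HN_classes E0) e.
have sumE t : \sum_(a <- t) g (vcl v a.2)
    = \sum_(b <- [seq (a.1, K0_class a.2) | a <- t]) g (v b.2).
  by rewrite big_map.
by rewrite !sumE e.
Qed.

Lemma massE E s : ~ is_zero E -> HN_filtration sigma.2 E s ->
  mass v sigma E = \sum_(a <- s) cmod (sigma.1 (vcl v a.2)).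
Proof.
by move=> E0 HNs; exact: (sum_vcl_HN (fun x => cmod (sigma.1 x)) E0 HNs).
Qed.

Lemma HN_in E a : ~ is_zero E -> a \in HN sigma E ->
  ~ is_zero a.2 /\ sigma.2 a.1 a.2.
Proof.
move=> E0 aHN; have [Ei [_ _ _ h]] := HN_P E0.
have := h (index a (HN sigma E)); rewrite index_mem aHN => /(_ isT).
by rewrite nth_index // => -[].
Qed.

Lemma cmod_semistable_gt0 phi E : ~ is_zero E -> sigma.2 phi E ->
  0 < cmod (sigma.1 (vcl v E)).
Proof.
move=> E0 /(stability_phase E0)[c c0 ->].
by rewrite (cmodM c%:C) cmod_cphase mulr1 (cmodC (ltW c0)).
Qed.

Lemma HN_neq0 E : ~ is_zero E -> HN sigma E != [::].
Proof.
by move=> E0; apply/eqP => h; have := HN_P E0; rewrite h => /HN_nil.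
Qed.

Lemma sum_HN_gt0 (g : L -> R) E : ~ is_zero E ->
  (forall phi A, ~ is_zero A -> sigma.2 phi A -> 0 < g (vcl v A)) ->
  0 < \sum_(a <- HN sigma E) g (vcl v a.2).
Proof.
move=> E0 g0; have := HN_neq0 E0; have := HN_in E0.
case: (HN sigma E) => // a s h _; rewrite big_cons ltr_wpDr //.
  rewrite big_seq sumr_ge0 // => b bs; apply: ltW.
  by have [nz Pb] := h b (mem_behead (s := a :: s) bs); exact: g0 nz Pb.
by have [nz Pa] := h a (mem_head _ _); exact: g0 nz Pa.
Qed.

Lemma mass_gt0 E : ~ is_zero E -> 0 < mass v sigma E.
Proof.
move=> E0; apply: (sum_HN_gt0 (g := fun x => cmod (sigma.1 x))) => //.
exact: cmod_semistable_gt0.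
Qed.

Lemma mass_semistable phi E : ~ is_zero E -> sigma.2 phi E ->
  mass v sigma E = cmod (sigma.1 (vcl v E)).
Proof.
by move=> E0 PE; rewrite (massE E0 (HN_single E0 PE)) big_seq1.
Qed.

Section Isomorphic.
Variables E E' : Ob T.
Hypotheses (E0 : ~ is_zero E) (EE' : isom E E').

Let E'0 := isom_nonzero EE' E0.
Let HNE' := HN_isom EE' (HN_P E0).

Lemma isom_phi_plus : phi_plus sigma E = phi_plus sigma E'.
Proof. by rewrite (phi_plusE E'0 HNE'). Qed.

Lemma isom_phi_minus : phi_minus sigma E = phi_minus sigma E'.
Proof. by rewrite (phi_minusE E'0 HNE'). Qed.

Lemma isom_mass : mass v sigma E = mass v sigma E'.
Proof. by rewrite (massE E'0 HNE'). Qed.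

End Isomorphic.

End Accessors.

Section Metric.

Lemma ln_ratio_le (m m' d : R) : 0 < m -> 0 < m' ->
  m <= expR d * m' -> m' <= expR d * m -> `|ln (m / m')| <= d.
Proof.
move=> m0 m'0 h h'; rewrite ln_div ?posrE // ler_norml.
have := h; rewrite -ler_ln ?posrE ?mulr_gt0 ?expR_gt0 // lnM ?posrE ?expR_gt0 // expRK.
have := h'; rewrite -ler_ln ?posrE ?mulr_gt0 ?expR_gt0 // lnM ?posrE ?expR_gt0 // expRK.
by move=> *; apply/andP; split; lra.
Qed.

Lemma dB_leP (sigma tau : prestab R T L) (D : \bar R) :
  (dB v sigma tau <= D)%E <-> forall E, ~ is_zero E ->
    [/\ ((`|phi_plus sigma E - phi_plus tau E|)%:E <= D)%E,
        ((`|phi_minus sigma E - phi_minus tau E|)%:E <= D)%E &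
        ((`|ln (mass v sigma E / mass v tau E)|)%:E <= D)%E].
Proof.
split=> [h E E0|h].
  have ub x : [set (`|phi_plus sigma E - phi_plus tau E|)%:E;
         (`|phi_minus sigma E - phi_minus tau E|)%:E;
         (`|ln (mass v sigma E / mass v tau E)|)%:E] x -> (x <= D)%E.
    by move=> hx; apply: le_trans h; apply: ereal_sup_ubound; exists E.
  by split; apply: ub; [left; left|left; right|right].
by apply: ge_ereal_sup => x [E /h[h1 h2 h3]] [[->|->]|->].
Qed.

Lemma dB_sym (sigma tau : prestab R T L) : is_stability iota v sigma ->
  is_stability iota v tau -> dB v sigma tau = dB v tau sigma.
Proof.
move=> sP tP; rewrite /dB; congr ereal_sup; apply: eq_bigcupr => E E0.
rewrite distrC [in X in [set _; X; _]]distrC -[mass v sigma E / _]invf_div.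
by rewrite lnV ?normrN // posrE divr_gt0 // (mass_gt0 _ E0).
Qed.

Lemma dB_triangle (sigma tau rho : prestab R T L) :
  is_stability iota v sigma -> is_stability iota v tau ->
  is_stability iota v rho ->
  (dB v sigma rho <= dB v sigma tau + dB v tau rho)%E.
Proof.
move=> sP tP rP; apply/dB_leP => E E0.
have /dB_leP/(_ _ E0)[h1 h2 h3] := lexx (dB v sigma tau).
have /dB_leP/(_ _ E0)[k1 k2 k3] := lexx (dB v tau rho).
have tri (x y z : R) : ((`|x - z|)%:E <= (`|x - y|)%:E + (`|y - z|)%:E)%E.
  by rewrite -EFinD lee_fin ler_distD.
split.
- exact: le_trans (tri _ (phi_plus tau E) _) (leeD h1 k1).
- exact: le_trans (tri _ (phi_minus tau E) _) (leeD h2 k2).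
- apply: le_trans (leeD h3 k3); rewrite -EFinD lee_fin.
  have m1 := mass_gt0 sP E0; have m2 := mass_gt0 tP E0; have m3 := mass_gt0 rP E0.
  rewrite !ln_div ?posrE //; exact: ler_distD.
Qed.

Lemma dB_refl (sigma : prestab R T L) : is_stability iota v sigma ->
  (dB v sigma sigma <= 0)%E.
Proof.
move=> sP; apply/dB_leP => E E0; rewrite !subrr normr0; split=> //.
by rewrite divff ?gt_eqF ?(mass_gt0 sP E0) // ln1 normr0.
Qed.

Lemma dB_ge0 (sigma tau : prestab R T L) : nonzero_category T ->
  (0 <= dB v sigma tau)%E.
Proof.
move=> [E E0]; have /dB_leP/(_ _ E0)[h _ _] := lexx (dB v sigma tau).
by apply: le_trans h; rewrite lee_fin.
Qed.

End Metric.

(** * Stability conditions with the same semistable objects and moved phases *)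

Section Reparametrization.
Variables (sigma : prestab R T L) (Z : L -> R[i]) (f f' : R -> R).
Hypothesis sigmaP : is_stability iota v sigma.
Hypotheses (fK : cancel f f') (f'K : cancel f' f).
Hypothesis f_incr : {homo f : x y / x < y}.
Hypothesis f_period : forall phi, f (phi + 1) = f phi + 1.

Let tau : prestab R T L := (Z, fun phi => sigma.2 (f phi)).

Let f'_incr : {homo f' : x y / x < y}.
Proof.
move=> x y xy; rewrite ltNge; apply/negP; rewrite le_eqVlt => /predU1P[e|/f_incr].
  by move: xy; rewrite -(f'K x) -(f'K y) e ltxx.
by rewrite !f'K => /(lt_trans xy); rewrite ltxx.
Qed.

Lemma HN_reparametrized E : ~ is_zero E ->
  HN_filtration tau.2 E [seq (f' a.1, a.2) | a <- HN sigma E].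
Proof.
move=> E0; apply: HN_reparam f'_incr _ (HN_P sigmaP E0) => phi A PA.
by rewrite /tau /= f'K.
Qed.

(** Serves both the action of C and the flow. The filtrations are those of [sigma] with phases moved
    by [f'], and [K] transfers the support property. *)
Lemma is_stability_reparam (K : R) : {morph Z : x y / x + y} ->
  (forall phi x, same_ray (sigma.1 x) (cphase (f phi)) -> same_ray (Z x) (cphase phi)) ->
  0 < K -> (forall x, cmod (sigma.1 x) <= K * cmod (Z x)) ->
  is_stability iota v tau.
Proof.
move=> Z_add ray K0 K_le; split.
- by split=> // phi; exact: stability_additive.
- move=> phi E E0 PE; apply: ray; exact: (stability_phase sigmaP) E0 PE.
- by move=> phi E; rewrite f_period; exact: (stability_shift sigmaP).
- by move=> phi1 phi2 E1 E2 /f_incr; exact: (stability_hom sigmaP).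
split; first by move=> E /HN_reparametrized h; eexists; exact: h.
have [C C0 h] := stability_support sigmaP; exists (C * K); first exact: mulr_gt0.
move=> phi E E0 PE; apply: lt_le_trans (h _ _ E0 PE) _.
by rewrite -mulrA ler_pM2l.
Qed.

Hypothesis tauP : is_stability iota v tau.

Lemma phi_plus_reparam E : ~ is_zero E ->
  phi_plus tau E = f' (phi_plus sigma E).
Proof.
move=> E0; rewrite (phi_plusE tauP E0 (HN_reparametrized E0)) /phi_plus.
by have := HN_neq0 sigmaP E0; case: (HN sigma E).
Qed.

Lemma phi_minus_reparam E : ~ is_zero E ->
  phi_minus tau E = f' (phi_minus sigma E).
Proof.
move=> E0; rewrite (phi_minusE tauP E0 (HN_reparametrized E0)) /phi_minus.
have := HN_neq0 sigmaP E0; case: (HN sigma E) => //= a s _.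
by rewrite -map_comp (map_comp f' fst) last_map.
Qed.

Lemma mass_reparam E : ~ is_zero E ->
  mass v tau E = \sum_(a <- HN sigma E) cmod (Z (vcl v a.2)).
Proof.
by move=> E0; rewrite (massE tauP E0 (HN_reparametrized E0)) big_map.
Qed.

End Reparametrization.

Section ComplexAction.
Implicit Types (sigma tau : prestab R T L) (lambda mu : R[i]).

Lemma Re_mulpi lambda : complex.Re (- ((0 +i* pi) * lambda)) = pi * complex.Im lambda.
Proof. by case: lambda => a b /=; ring. Qed.

Lemma actCD sigma lambda mu :
  actC (actC sigma lambda) mu = actC sigma (lambda + mu).
Proof.
congr pair; apply: funext => x /=.
  by rewrite mulrA -cexpD -opprD -mulrDr [mu + _]addrC.
by rewrite addrAC -addrA; case: lambda mu => [a b] [c d].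
Qed.

Lemma actC0 sigma : actC sigma 0 = sigma.
Proof.
case: sigma => Z P; congr pair; apply: funext => x /=.
  by rewrite mulr0 oppr0 cexp0 mul1r.
by rewrite addr0.
Qed.

Lemma is_stability_actC sigma lambda :
  is_stability iota v sigma -> is_stability iota v (actC sigma lambda).
Proof.
move=> sP.
pose u := cexp (- ((0 +i* pi) * lambda)).
have u0 : 0 < cmod u by rewrite cmod_cexp expR_gt0.
apply: (is_stability_reparam (f' := fun x => x - complex.Re lambda)
  sP _ _ _ _ (K := (cmod u)^-1)).
- by move=> x; rewrite subrK.
- by move=> x y; rewrite ltrD2r.
- by move=> phi; rewrite addrAC.
- by move=> x y; rewrite (stability_addC sP) mulrDr.
- move=> phi x [c c0 ->]; exists (c * cmod u); first exact: mulr_gt0.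
  rewrite cmod_cexp Re_mulpi mulrCA.
  have -> : (c * expR (pi * complex.Im lambda))%:C
    = c%:C * (expR (pi * complex.Im lambda))%:C by exact: rmorphM.
  rewrite -(mulrA c%:C); congr (_ * _).
  have -> : (expR (pi * complex.Im lambda))%:C
    = cexp (pi * complex.Im lambda)%:C :> R[i].
    by rewrite /cexp /= cos0 sin0 mulr1.
  rewrite /cphase -!cexpD; congr cexp.
  by case: lambda {u u0} => a b; apply: complexP => /=; ring.
- by rewrite invr_gt0.
- by move=> x; rewrite (cmodM u) mulrA mulVf ?gt_eqF // mul1r.
Qed.

Lemma actC_invariants sigma lambda E : is_stability iota v sigma -> ~ is_zero E ->
  [/\ phi_plus (actC sigma lambda) E = phi_plus sigma E - complex.Re lambda,
    phi_minus (actC sigma lambda) E = phi_minus sigma E - complex.Re lambda &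
    mass v (actC sigma lambda) E = expR (pi * complex.Im lambda) * mass v sigma E].
Proof.
move=> sP E0; have tP := is_stability_actC lambda sP.
have fK : cancel (fun x : R => x - complex.Re lambda) (fun x => x + complex.Re lambda).
  by move=> x; rewrite subrK.
have f_incr : {homo (fun x : R => x + complex.Re lambda) : x y / x < y}.
  by move=> x y; rewrite ltrD2r.
split.
- exact: (phi_plus_reparam (f' := fun x => x - complex.Re lambda) sP fK f_incr tP E0).
- exact: (phi_minus_reparam (f' := fun x => x - complex.Re lambda) sP fK f_incr tP E0).
rewrite (mass_reparam (f' := fun x => x - complex.Re lambda) sP fK f_incr tP E0).
rewrite /mass mulr_sumr; apply: eq_bigr => a _.
by rewrite (cmodM (cexp _)) cmod_cexp Re_mulpi.
Qed.

Lemma dB_actC sigma tau lambda :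
  is_stability iota v sigma -> is_stability iota v tau ->
  dB v (actC sigma lambda) (actC tau lambda) = dB v sigma tau.
Proof.
move=> sP tP; rewrite /dB; congr ereal_sup; apply: eq_bigcupr => E E0.
have [-> -> ->] := actC_invariants lambda sP E0.
have [-> -> ->] := actC_invariants lambda tP E0.
rewrite !opprB !addrA !subrK -!mulf_div divff ?mul1r ?gt_eqF ?expR_gt0 //.
Qed.

Lemma dB_actC_lip sigma lambda mu : is_stability iota v sigma ->
  (dB v (actC sigma lambda) (actC sigma mu)
   <= (`|complex.Re (lambda - mu)| + pi * `|complex.Im (lambda - mu)|)%:E)%E.
Proof.
move=> sP; apply/dB_leP => E E0.
have m0 := mass_gt0 sP E0.
have [-> -> ->] := actC_invariants lambda sP E0.
have [-> -> ->] := actC_invariants mu sP E0.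
have reE : complex.Re (lambda - mu) = complex.Re lambda - complex.Re mu.
  by case: lambda mu => [a b] [c d].
have imE : complex.Im (lambda - mu) = complex.Im lambda - complex.Im mu.
  by clear; case: lambda mu => [a b] [c d].
rewrite reE imE; move: (complex.Re lambda) (complex.Im lambda).
move: (complex.Re mu) (complex.Im mu) => c d a b.
have e (x : R) : `|x - a - (x - c)| = `|a - c| by rewrite opprB addrC addrA subrK distrC.
rewrite !e !lee_fin; split.
- by rewrite lerDl mulr_ge0 // pi_ge0.
- by rewrite lerDl mulr_ge0 // pi_ge0.
rewrite -mulf_div divff ?gt_eqF // mulr1 -expRN -expRD expRK -mulrN -mulrDr normrM.
by rewrite (ger0_norm (pi_ge0 R)) lerDr.
Qed.

End ComplexAction.

(** * The one-parameter group of stretches *)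

Section Flow.
Implicit Types (sigma tau : prestab R T L).

(** The action of the lift [turn t] of the matrix [diag2 (expR (- t)) (expR t)]; central charges are
    moved by the inverse matrix. *)
Definition flow sigma (t : R) : prestab R T L :=
  (fun x => stretch t (sigma.1 x), fun phi => sigma.2 (turn t phi)).

Lemma flowD sigma (s t : R) : flow (flow sigma s) t = flow sigma (s + t).
Proof.
congr pair; apply: funext => x /=; first by rewrite stretch_add addrC.
by rewrite turn_comp.
Qed.

Lemma flow0 sigma : flow sigma 0 = sigma.
Proof.
case: sigma => Z P; congr pair; apply: funext => x /=; first by rewrite stretch0.
by rewrite turn0.
Qed.

Let turnNK t : cancel (@turn R (- t)) (@turn R t).
Proof. by move=> x; rewrite turn_comp subrr turn0. Qed.

Lemma is_stability_flow sigma (t : R) :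
  is_stability iota v sigma -> is_stability iota v (flow sigma t).
Proof.
move=> sP; apply: (is_stability_reparam (f' := turn (- t)) sP (@turnNK t)
  (@turn_incr _ t) (@turn_period _ t) (K := expR `|t|)).
- by move=> x y; rewrite (stability_addC sP) stretchD.
- move=> phi x [c c0 ->]; have [d d0 ed] := turn_compat t phi.
  exists (c / d); first exact: divr_gt0.
  have -> : cphase (turn t phi) = d^-1%:C * stretch (- t) (cphase phi).
    rewrite ed (mulrA _ d%:C).
    have -> : d^-1%:C * d%:C = 1 by rewrite -rmorphM /= mulVf ?gt_eqF.
    by rewrite mul1r.
  have -> : (c / d)%:C = c%:C * d^-1%:C by exact: rmorphM.
  by rewrite !stretchZ stretch_add subrr stretch0 (mulrA c%:C).
- exact: expR_gt0.
- move=> x; rewrite -{1}[sigma.1 x]stretch0 -(addNr t) -stretch_add -(normrN t).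
  exact: cmod_stretch.
Qed.

(** Phases are compared by [turn_lip]. Masses are sums over the same factors, so [cmod_stretch]
    compares them term by term. *)
Lemma dB_flow sigma (s t : R) : is_stability iota v sigma ->
  (dB v (flow sigma s) (flow sigma t) <= (`|s - t|)%:E)%E.
Proof.
move=> sP; apply/dB_leP => E E0.
have fP r := is_stability_flow r sP.
have plusE r : phi_plus (flow sigma r) E = turn (- r) (phi_plus sigma E).
  exact: (phi_plus_reparam sP (@turnNK r) (@turn_incr _ r) (fP r) E0).
have minusE r : phi_minus (flow sigma r) E = turn (- r) (phi_minus sigma E).
  exact: (phi_minus_reparam sP (@turnNK r) (@turn_incr _ r) (fP r) E0).
have stE : `|- s - - t| = `|s - t| by rewrite opprK addrC distrC.
rewrite !plusE !minusE !lee_fin -{1 2}stE; split; [exact: turn_lip|exact: turn_lip|].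
have massle r r' : mass v (flow sigma r) E <= expR `|r - r'| * mass v (flow sigma r') E.
  rewrite !(mass_reparam sP (@turnNK _) (@turn_incr _ _) (fP _) E0) mulr_sumr.
  apply: ler_sum => a _; rewrite -{1}(subrK r' r) -stretch_add; exact: cmod_stretch.
have [m1 m2] := (mass_gt0 (fP s) E0, mass_gt0 (fP t) E0).
apply: ln_ratio_le m1 m2 (massle s t) _.
by rewrite distrC; exact: massle.
Qed.

End Flow.

End Invariants.

(** * Autoequivalences *)

Section Pullback.
Variables (R : realType) (k : fieldType) (T : tricat k) (L : zmodType).
Variables (V : normedModType R) (iota : {additive L -> V}).
Variable v : {additive K0 T -> L}.
Implicit Types (sigma tau : prestab R T L) (E : Ob T).

(** The inverse action, with semistability tested on [F E], which makes isomorphism closure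
    automatic. Taken for a quasi-inverse of [F], it becomes the action of [F]; see [actAutE]. *)
Definition pullback (F : functor T T) (a : L -> L) sigma : prestab R T L :=
  (fun x => sigma.1 (a x), fun phi => [set E | sigma.2 phi (F E)]).

Variables (F G : functor T T) (a : L -> L) (K : R).
Hypothesis FG : quasi_inverse F G.
Hypothesis G_triangle : forall X Y Z : Ob T,
  is_triangle X Y Z -> is_triangle (G X) (G Y) (G Z).
Hypothesis F_shift : forall X : Ob T, isom (F (shift X)) (shift (F X)).
Hypothesis a_add : {morph a : x y / x + y}.
Hypothesis F_vcl : forall E, vcl v (F E) = a (vcl v E).
Hypotheses (K0 : 0 < K) (a_bound : forall x, `|iota x| <= K * `|iota (a x)|).

Let F_nonzero E : ~ is_zero E -> ~ is_zero (F E).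
Proof. by move=> E0 FE0; apply: E0; exact: (quasi_inverse_zero_reflect FG FE0). Qed.

(** [G] carries a filtration of [F E] to one of [G (F E)], which is isomorphic to [E]. *)
Lemma HN_pullback sigma E s : is_stability iota v sigma ->
  HN_filtration sigma.2 (F E) s ->
  HN_filtration (pullback F a sigma).2 E [seq (b.1, G b.2) | b <- s].
Proof.
move=> sP HNs; apply: (HN_isom (quasi_inverse_isoml FG E)).
apply: HN_functor HNs => // [X GX0|phi A PA].
  exact: (quasi_inverse_zero_reflect (quasi_inverse_sym FG) GX0).
by apply: (stability_isom sP) PA; exact: isom_sym (quasi_inverse_isomr FG A).
Qed.

Lemma is_stability_pullback sigma :
  is_stability iota v sigma -> is_stability iota v (pullback F a sigma).
Proof.
move=> sP; split.
- split=> [x y|phi] /=; first by rewrite a_add (stability_addC sP).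
  have [P0 PD PI] := stability_additive sP phi; split.
  + by move=> X X0; apply: P0; exact: functor_zero.
  + by move=> A B S /(functor_biproduct F); exact: PD.
  + by move=> X Y /(functor_isom F); exact: PI.
- by move=> phi E /F_nonzero E0 PE; rewrite -F_vcl; exact: (stability_phase sP) E0 PE.
- move=> phi E; split=> /=.
    move=> /(stability_shift sP)[E' PE' FEE']; exists (G E').
      by apply: (stability_isom sP) PE'; exact: isom_sym (quasi_inverse_isomr FG E').
    apply: (quasi_inverse_isom_reflect FG); apply: (isom_trans FEE').
    apply: isom_trans (isom_sym (F_shift _)).
    by apply: functor_isom; exact: isom_sym (quasi_inverse_isomr FG E').
  move=> [E' PE' EE']; apply/(stability_shift sP); exists (F E') => //.
  exact: isom_trans (functor_isom F EE') (F_shift E').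
- move=> phi1 phi2 E1 E2 lt P1 P2 f; apply: (quasi_inverse_faithful FG).
  rewrite (stability_hom sP lt P1 P2 (fmap F f)).
  by rewrite (lin0 (@fmap_linear _ _ _ F _ _)).
split.
  move=> E /F_nonzero/(stability_HN sP)[s HNs].
  by eexists; exact: HN_pullback HNs.
have [C C0 h] := stability_support sP; exists (K * C); first exact: mulr_gt0.
move=> phi E /F_nonzero E0 PE /=; rewrite -F_vcl -mulrA.
apply: le_lt_trans (a_bound _) _; rewrite -F_vcl ltr_pM2l //.
exact: h E0 PE.
Qed.

Section Invariance.
Variables (sigma : prestab R T L) (E : Ob T).
Hypotheses (sigmaP : is_stability iota v sigma) (E0 : ~ is_zero E).

Let HNE := HN_pullback sigmaP (HN_P sigmaP (F_nonzero E0)).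
Let tauP := is_stability_pullback sigmaP.

Lemma phi_plus_pullback : phi_plus (pullback F a sigma) E = phi_plus sigma (F E).
Proof. by rewrite (phi_plusE tauP E0 HNE) -map_comp. Qed.

Lemma phi_minus_pullback : phi_minus (pullback F a sigma) E = phi_minus sigma (F E).
Proof. by rewrite (phi_minusE tauP E0 HNE) -map_comp. Qed.

Lemma mass_pullback : mass v (pullback F a sigma) E = mass v sigma (F E).
Proof.
rewrite (massE tauP E0 HNE) big_map; apply: eq_bigr => b _ /=.
by rewrite -F_vcl (isom_vcl v (quasi_inverse_isomr FG b.2)).
Qed.

End Invariance.

(** The pulled-back invariants of [E] are those of [F E], and every object is isomorphic to some
    [F (G E)], so both suprema range over the same values. *)
Lemma dB_pullback sigma tau : is_stability iota v sigma ->
  is_stability iota v tau ->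
  dB v (pullback F a sigma) (pullback F a tau) = dB v sigma tau.
Proof.
move=> sP tP; apply/eqP; rewrite eq_le; apply/andP; split.
  apply/dB_leP => E E0; rewrite !phi_plus_pullback // !phi_minus_pullback //.
  rewrite !mass_pullback //.
  by have /dB_leP/(_ _ (F_nonzero E0)) := lexx (dB v sigma tau).
apply/dB_leP => E E0.
have EFGE := isom_sym (quasi_inverse_isomr FG E).
have GE0 : ~ is_zero (G E).
  by move=> /(functor_zero F); exact: isom_nonzero EFGE E0.
rewrite (isom_phi_plus sP E0 EFGE) (isom_phi_plus tP E0 EFGE).
rewrite (isom_phi_minus sP E0 EFGE) (isom_phi_minus tP E0 EFGE).
rewrite (isom_mass sP E0 EFGE) (isom_mass tP E0 EFGE).
rewrite -!phi_plus_pullback // -!phi_minus_pullback // -!mass_pullback //.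
by have /dB_leP/(_ _ GE0) := lexx (dB v (pullback F a sigma) (pullback F a tau)).
Qed.

End Pullback.

Section Autoequivalence.
Variables (R : realType) (k : fieldType) (T : tricat k) (L : zmodType).
Variables (V : normedModType R) (iota : {additive L -> V}).
Hypothesis iotaP : is_scalar_extension iota.
Variable v : {additive K0 T -> L}.
Variable alpha : autoeq T -> zaut L.
Hypothesis alphaP : forall (F : autoeq T) (x : K0 T), v (K0_map F x) = alpha F (v x).
Variables (F : autoeq T) (G : functor T T).
Hypothesis FG : quasi_inverse F G.
Implicit Types (sigma tau : prestab R T L) (E : Ob T).

Lemma aut_vcl E : vcl v (F E) = alpha F (vcl v E).
Proof. by rewrite /vcl -K0_map_class alphaP. Qed.

Lemma aut_inv_vcl E : vcl v (G E) = zaut_inv (alpha F) (vcl v E).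
Proof.
by rewrite -(isom_vcl v (quasi_inverse_isomr FG E)) aut_vcl zaut_funK.
Qed.

Lemma aut_shift X : isom (F (shift X)) (shift (F X)).
Proof. by have [theta [h _ _]] := aut_exact F; exists (theta X). Qed.

Lemma aut_inv_shift X : isom (G (shift X)) (shift (G X)).
Proof.
apply: (quasi_inverse_isom_reflect FG).
apply: (isom_trans (quasi_inverse_isomr FG _)).
apply: (isom_trans _ (isom_sym (aut_shift _))).
by apply: functor_isom; exact: isom_sym (quasi_inverse_isomr FG X).
Qed.

Lemma zaut_invD (g : zaut L) : {morph zaut_inv g : x y / x + y}.
Proof.
move=> x y; apply: (can_inj (zaut_funK g)).
by rewrite raddfD !zaut_invK.
Qed.

(** The inverse is given as a bare function; it inherits additivity from [g]. The bound preserves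
    the support property under pullback. *)
Lemma zaut_inv_bounded (g : zaut L) :
  exists2 K : R, 0 < K & forall x, `|iota (zaut_inv g x)| <= K * `|iota x|.
Proof.
have zmod : zmod_morphism (zaut_inv g).
  exact: can2_zmod_morphism (zaut_funK g) (zaut_invK g).
pose A : {additive L -> L} := HB.pack (zaut_inv g)
  (GRing.isZmodMorphism.Build L L (zaut_inv g) zmod).
exact: (scalar_extension_bounded iotaP A).
Qed.

Lemma is_stability_pullF sigma : is_stability iota v sigma ->
  is_stability iota v (pullback F (alpha F) sigma).
Proof.
have [K K0 Kle] := zaut_inv_bounded (alpha F).
apply: (is_stability_pullback FG _ aut_shift (raddfD (alpha F)) aut_vcl K0).
  by move=> X Y Z; exact: quasi_inverse_triangle FG.
by move=> x; rewrite -{1}(zaut_funK (alpha F) x).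
Qed.

Lemma dB_pullF sigma tau : is_stability iota v sigma -> is_stability iota v tau ->
  dB v (pullback F (alpha F) sigma) (pullback F (alpha F) tau) = dB v sigma tau.
Proof.
have [K K0 Kle] := zaut_inv_bounded (alpha F).
apply: (dB_pullback FG _ aut_shift (raddfD (alpha F)) aut_vcl K0).
  by move=> X Y Z; exact: quasi_inverse_triangle FG.
by move=> x; rewrite -{1}(zaut_funK (alpha F) x).
Qed.

Lemma actAutE sigma : is_stability iota v sigma ->
  actAut alpha F sigma = pullback G (zaut_inv (alpha F)) sigma.
Proof.
move=> sP; congr pair; apply/funext => phi; apply/seteqP; split=> E /=.
  move=> [E' PE' EFE']; apply: (stability_isom sP) PE'; apply: isom_sym.
  exact: isom_trans (functor_isom G EFE') (quasi_inverse_isoml FG E').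
by move=> PGE; exists (G E) => //; exact: isom_sym (quasi_inverse_isomr FG E).
Qed.

Lemma is_stability_actAut sigma : is_stability iota v sigma ->
  is_stability iota v (actAut alpha F sigma).
Proof.
move=> sP; rewrite actAutE //.
have [K K0 Kle] := scalar_extension_bounded iotaP (alpha F).
apply: (is_stability_pullback (quasi_inverse_sym FG) _ aut_inv_shift
  (@zaut_invD (alpha F)) aut_inv_vcl K0) => //.
  by move=> X Y Z; exact: exact_triangle.
by move=> x; rewrite -{1}(zaut_invK (alpha F) x).
Qed.

Lemma dB_actAut sigma tau : is_stability iota v sigma -> is_stability iota v tau ->
  dB v (actAut alpha F sigma) (actAut alpha F tau) = dB v sigma tau.
Proof.
move=> sP tP; rewrite !actAutE //.
have [K K0 Kle] := scalar_extension_bounded iotaP (alpha F).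
apply: (dB_pullback (quasi_inverse_sym FG) _ aut_inv_shift
  (@zaut_invD (alpha F)) aut_inv_vcl K0 _ sP tP).
  by move=> X Y Z; exact: exact_triangle.
by move=> x; rewrite -{1}(zaut_invK (alpha F) x).
Qed.

Lemma actAut_pullF sigma : is_stability iota v sigma ->
  actAut alpha F (pullback F (alpha F) sigma) = sigma.
Proof.
move=> sP; rewrite actAutE; last exact: is_stability_pullF.
case: sigma sP => Z P sP; congr pair; apply/funext => x /=.
  by rewrite zaut_invK.
apply/seteqP; split=> E /=; apply: (stability_isom sP).
  exact: (quasi_inverse_isomr FG E).
exact: isom_sym (quasi_inverse_isomr FG E).
Qed.

Lemma pullF_actAut sigma : is_stability iota v sigma ->
  pullback F (alpha F) (actAut alpha F sigma) = sigma.
Proof.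
move=> sP; rewrite actAutE //.
case: sigma sP => Z P sP; congr pair; apply/funext => x /=.
  by rewrite zaut_funK.
apply/seteqP; split=> E /=; apply: (stability_isom sP).
  exact: (quasi_inverse_isoml FG E).
exact: isom_sym (quasi_inverse_isoml FG E).
Qed.

End Autoequivalence.

(** * Components and the quotient by C *)

Section Topology.
Variables (R : realType) (k : fieldType) (T : tricat k) (L : zmodType).
Variables (V : normedModType R) (iota : {additive L -> V}).
Variable v : {additive K0 T -> L}.
Implicit Types (sigma tau rho : stab iota v) (X : set (stab iota v)).

Lemma stab_eq sigma tau : stab_val sigma = stab_val tau -> sigma = tau.
Proof.
case: sigma tau => [s sP] [t tP] /= st; rewrite st in sP *.
by rewrite (Prop_irrelevance sP tP).
Qed.

Lemma stab_open (U : set (stab iota v)) : dB_open U -> open U.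
Proof. by []. Qed.

Lemma stab_continuous (S : topologicalType) (f : S -> stab iota v) :
  (forall x (e : R), 0 < e -> \forall y \near x, (dB v (f x) (f y) < e%:E)%E) ->
  continuous f.
Proof.
move=> f_near x B /=; rewrite nbhsE => -[U [Uopen Ufx] UB].
have [e e0 eU] : exists2 e : R, 0 < e &
  forall tau, (dB v (f x) tau < e%:E)%E -> U tau by exact: Uopen.
by have := f_near x e e0; apply: filterS => y /eU/UB.
Qed.

Section Component.
Variable X : set (stab iota v).
Hypothesis X_comp : is_component X.

Lemma component_max sigma (B : set (stab iota v)) :
  X sigma -> connected B -> B sigma -> B `<=` X.
Proof.
have [sigma0 ->] := X_comp => /same_connected_component -> B_conn Bs.
exact: connected_component_max.
Qed.

Lemma component_conn : connected X.
Proof. by have [sigma0 ->] := X_comp; exact: component_connected. Qed.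

(** A Lipschitz path is continuous, so its range is connected. *)
Lemma component_path (f : R -> stab iota v) (K s t : R) :
  (forall x y, (dB v (f x) (f y) <= (K * `|x - y|)%:E)%E) -> X (f s) -> X (f t).
Proof.
move=> f_lip Xfs; have f_cont : continuous f.
  apply: stab_continuous => x e e0.
  have K0 : 0 < `|K| + 1 by rewrite ltr_wpDl.
  have d0 : 0 < e / (`|K| + 1) by rewrite divr_gt0.
  apply: filterS (nbhsx_ballx x _ d0) => y; rewrite -ball_normE /= => xy.
  apply: le_lt_trans (f_lip x y) _; rewrite lte_fin.
  apply: le_lt_trans (_ : _ <= (`|K| + 1) * `|x - y|) _.
    by rewrite ler_wpM2r //; apply: le_trans (ler_norm K) _; rewrite lerDl.
  by rewrite mulrC -ltr_pdivlMr.
apply: (component_max Xfs (B := range f)); [|by exists s|by exists t].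
apply: connected_continuous_connected; last exact: continuous_subspaceT.
by apply/connected_intervalP.
Qed.

(** By the triangle inequality, the points at finite distance from [sigma] form an open set with
    open complement. *)
Lemma component_dB_fin sigma tau : X sigma -> X tau ->
  (dB v sigma tau < +oo)%E.
Proof.
move=> Xs Xt; pose U := [set rho : stab iota v | (dB v sigma rho < +oo)%E].
have ball (rho rho' : stab iota v) : (dB v rho rho' < 1%:E)%E ->
    (dB v sigma rho < +oo)%E -> (dB v sigma rho' < +oo)%E.
  move=> lt1 fin; apply: le_lt_trans (dB_triangle (stabP sigma) (stabP rho) (stabP rho')) _.
  by apply: lte_add_pinfty => //; apply: lt_trans lt1 _; rewrite ltry.
have U_open : open U.
  by apply: stab_open => rho Urho; exists 1 => // rho' /ball; exact.
have UC_open : open (~` U).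
  apply: stab_open => rho Urho; exists 1 => // rho' lt1 Urho'; apply: Urho.
  by apply: ball Urho'; rewrite (dB_sym (stabP rho') (stabP rho)).
have XU : X `&` U = X.
  apply: component_conn.
  - exists sigma; split=> //.
    by apply: le_lt_trans (dB_refl (stabP sigma)) _; rewrite ltry.
  - by exists U.
  - by exists U => //; rewrite -(setCK U); exact: open_closedC.
by move: Xt; rewrite -XU => -[].
Qed.

End Component.

(** The image of the component is connected and meets the component at [g sigma]. *)
Lemma component_image (X : set (stab iota v)) (g : stab iota v -> stab iota v) sigma :
  is_component X -> (forall tau rho, dB v (g tau) (g rho) = dB v tau rho) ->
  X sigma -> X (g sigma) -> forall tau, X tau -> X (g tau).
Proof.
move=> X_comp g_isom Xs Xgs tau Xtau.
have g_cont : continuous g.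
  apply/continuousP => U U_open; apply: stab_open => rho Ugrho.
  have [e e0 eU] : exists2 e : R, 0 < e &
    forall tau, (dB v (g rho) tau < e%:E)%E -> U tau by exact: U_open.
  by exists e => // rho' lt_e; apply: eU; rewrite g_isom.
apply: (component_max X_comp Xgs (B := g @` X)); [|by exists sigma|by exists tau].
apply: connected_continuous_connected; last exact: continuous_subspaceT.
exact: component_conn.
Qed.

End Topology.

(** Reduces the triangle inequality to finite distances, for which almost optimal [lambda] exist. *)
Lemma le_adde_fin (R : realType) (x y z : \bar R) : (0 <= y)%E -> (0 <= z)%E ->
  (y \is a fin_num -> z \is a fin_num -> (x <= y + z)%E) -> (x <= y + z)%E.
Proof. by case: y z => [y| |] [z| |] // y0 z0 h; rewrite ?leey //; exact: h. Qed.

(** * The quotient metric on C-orbits *)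

Section Quotient.
Variables (R : realType) (k : fieldType) (T : tricat k) (L : zmodType).
Variables (V : normedModType R) (iota : {additive L -> V}).
Variable v : {additive K0 T -> L}.
Hypothesis T_nz : nonzero_category T.
Implicit Types (sigma tau rho : prestab R T L).
Local Open Scope ereal_scope.

Lemma orbitC_actC sigma lambda : orbitC (actC sigma lambda) = orbitC sigma.
Proof.
apply/seteqP; split=> tau [mu _ <-] /=.
  by exists (lambda + mu)%R => //; rewrite actCD.
by exists (mu - lambda)%R => //; rewrite actCD addrC subrK.
Qed.

(** The chosen representatives are translates of [sigma] and [tau] by [lambda] and [mu]. As C acts
    by isometries, this only reindexes the infimum by [mu - lambda]. *)
Lemma dB_quotE sigma tau : is_stability iota v sigma -> is_stability iota v tau ->
  dB_quot v (orbitC sigma) (orbitC tau)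
  = ereal_inf [set dB v sigma (actC tau lambda) | lambda in [set: R[i]]].
Proof.
move=> sP tP; rewrite /dB_quot.
have repr rho : exists lambda, orbit_repr (orbitC rho) = actC rho lambda.
  have /(xgetPex ((fun=> 0%R), (fun=> set0)))[lambda _ e] : exists rho', orbitC rho rho'.
    by exists (actC rho (Algebra.zero : R[i])); exists (Algebra.zero : R[i]).
  by exists lambda; rewrite /orbit_repr -e.
have [lambda ->] := repr sigma; have [mu ->] := repr tau.
congr ereal_inf; apply/seteqP; split=> x [nu _ <-].
  exists (mu + nu - lambda)%R => //.
  rewrite -(dB_actC lambda sP (is_stability_actC _ tP)) actCD subrK.
  by rewrite actCD.
exists (nu + lambda - mu)%R => //.
rewrite -[in RHS](dB_actC lambda sP (is_stability_actC _ tP)) !actCD.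
by rewrite [(mu + _)%R]addrC subrK.
Qed.

Lemma dB_quot_le sigma tau lambda : is_stability iota v sigma ->
  is_stability iota v tau ->
  dB_quot v (orbitC sigma) (orbitC tau) <= dB v sigma (actC tau lambda).
Proof.
by move=> sP tP; rewrite dB_quotE //; apply: ereal_inf_lbound; exists lambda.
Qed.

Lemma dB_quot_le_dB sigma tau : is_stability iota v sigma ->
  is_stability iota v tau ->
  dB_quot v (orbitC sigma) (orbitC tau) <= dB v sigma tau.
Proof. by move=> sP tP; rewrite -{2}(actC0 tau); exact: dB_quot_le. Qed.

Lemma dB_quot_ge0 sigma tau : is_stability iota v sigma ->
  is_stability iota v tau -> 0 <= dB_quot v (orbitC sigma) (orbitC tau).
Proof.
move=> sP tP; rewrite dB_quotE //; apply: le_ereal_inf_tmp => _ [lambda _ <-].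
exact: dB_ge0.
Qed.

Lemma dB_quot_adherent sigma tau (e : R) : is_stability iota v sigma ->
  is_stability iota v tau -> dB_quot v (orbitC sigma) (orbitC tau) \is a fin_num ->
  (0 < e)%R -> exists lambda,
  dB v sigma (actC tau lambda) < dB_quot v (orbitC sigma) (orbitC tau) + e%:E.
Proof.
move=> sP tP; rewrite dB_quotE // => fin e0.
by have [_ [lambda _ <-] lt] := lb_ereal_inf_adherent e0 fin; exists lambda.
Qed.

(** If [lambda] and [mu] are optimal up to [e / 2] for the two summands, [mu + lambda] is a
    competitor for the left-hand side, since C acts by isometries. *)
Lemma dB_quot_triangle sigma tau rho : is_stability iota v sigma ->
  is_stability iota v tau -> is_stability iota v rho ->
  dB_quot v (orbitC sigma) (orbitC rho)
  <= dB_quot v (orbitC sigma) (orbitC tau) + dB_quot v (orbitC tau) (orbitC rho).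
Proof.
move=> sP tP rP.
apply: (le_adde_fin (dB_quot_ge0 sP tP) (dB_quot_ge0 tP rP)) => f1 f2.
apply/lee_addgt0Pr => e e0.
have e20 : (0 < e / 2)%R by rewrite divr_gt0.
have [lambda lt1] := dB_quot_adherent sP tP f1 e20.
have [mu lt2] := dB_quot_adherent tP rP f2 e20.
apply: le_trans (dB_quot_le (mu + lambda)%R sP rP) _.
apply: le_trans (dB_triangle sP (is_stability_actC lambda tP) (is_stability_actC _ rP)) _.
rewrite -actCD (dB_actC lambda tP (is_stability_actC mu rP)).
have -> : e%:E = (e / 2)%:E + (e / 2)%:E by rewrite -EFinD -splitr.
by rewrite addeACA; exact: (leeD (ltW lt1) (ltW lt2)).
Qed.

End Quotient.

(** * The lower bound for the flow *)

Section FlowLowerBound.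
Variables (R : realType) (k : fieldType) (T : tricat k) (L : zmodType).
Variables (V : normedModType R) (iota : {additive L -> V}).
Variable v : {additive K0 T -> L}.
Local Open Scope complex_scope.

(** Absolute values remove the parity sign by which [F] differs from a stretch on central
    charges. *)
Definition semistable_coords (sigma : prestab R T L) (x y : R) : Prop :=
  exists phi E, [/\ ~ is_zero E, sigma.2 phi E,
    `|complex.Re (sigma.1 (vcl v E))| = x & `|complex.Im (sigma.1 (vcl v E))| = y].

Variable sigma : prestab R T L.
Hypothesis sigmaP : is_stability iota v sigma.

Lemma flow_mass_bounds (t : R) lambda (D : R) phi E : ~ is_zero E -> sigma.2 phi E ->
  (dB v sigma (actC (flow sigma t) lambda) <= D%:E)%E ->
  let z := sigma.1 (vcl v E) in
  let kappa := expR (pi * complex.Im lambda) in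
  cmod z <= expR D * (kappa * cmod (stretch t z)) /\
  kappa * cmod (stretch t z) <= expR D * cmod z.
Proof.
move=> E0 PE /dB_leP/(_ _ E0)[_ _ ln_le] z kappa; move: ln_le; rewrite {}/z {}/kappa.
have fP := is_stability_flow t sigmaP.
have [_ _ ->] := actC_invariants lambda fP E0.
have PE' : (flow sigma t).2 (turn (- t) phi) E.
  by rewrite /flow /= turn_comp subrr turn0.
have := cmod_semistable_gt0 sigmaP E0 PE.
have := cmod_semistable_gt0 fP E0 PE'.
rewrite (mass_semistable sigmaP E0 PE) (mass_semistable fP E0 PE') lee_fin.
rewrite [(flow sigma t).1 _]/(stretch t (sigma.1 (vcl v E))).
set m' := cmod (stretch _ _); set m := cmod (sigma.1 _) => m'0 m0.
have km0 : 0 < expR (pi * complex.Im lambda) * m' by rewrite mulr_gt0 ?expR_gt0.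
move: (expR _ * m') km0 => km km0.
rewrite ln_div ?posrE // ler_norml => /andP[h1 h2].
split; rewrite -ler_ln ?posrE ?mulr_gt0 ?expR_gt0 // lnM ?posrE ?expR_gt0 // expRK; lra.
Qed.

(** Semistable objects close to either axis feed [stretch_limit], with the exponential of the
    distance as [D] and the rescaling of masses by [lambda] as [kappa]. *)
Lemma flow_lower_bound (t : R) lambda :
  (forall delta, 0 < delta -> exists x y,
     [/\ semistable_coords sigma x y, 0 < x & y <= delta * x]) ->
  (forall delta, 0 < delta -> exists x y,
     [/\ semistable_coords sigma x y, 0 < y & x <= delta * y]) ->
  (`|t|%:E <= dB v sigma (actC (flow sigma t) lambda))%E.
Proof.
move=> H1 H2; set d := dB _ _ _.
have [doo|[D [dD Dd]]] : d = +oo%E \/ exists D : R, (d <= D%:E)%E /\ (D%:E <= d)%E.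
  have d0 : (0 <= d)%E.
    have [x [y [[phi [E [E0 _ _ _]]] _ _]]] := H1 1 ltr01.
    by apply: dB_ge0; exists E.
  by case: d d0 => [r| |] // _; [right; exists r|left].
  by rewrite doo leey.
apply: le_trans Dd; rewrite lee_fin.
rewrite -ler_expR; apply: (@stretch_limit R t _ _ (expR_gt0 (pi * complex.Im lambda))).
  move=> delta /H1[x [y [[phi [E [E0 PE <- <-]]] x0 yx]]].
  exists (sigma.1 (vcl v E)); have [h1 h2] := flow_mass_bounds E0 PE dD.
  by split=> //; rewrite -normr_gt0.
move=> delta /H2[x [y [[phi [E [E0 PE <- <-]]] y0 xy]]].
exists (sigma.1 (vcl v E)); have [h1 h2] := flow_mass_bounds E0 PE dD.
by split=> //; rewrite -normr_gt0.
Qed.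

End FlowLowerBound.

(** * Pairs of coordinates moving along hyperbolas *)

Section HyperbolicCoordinates.
Variables (R : realType) (Q : R -> R -> Prop) (u m : R).
Hypotheses (u0 : 0 < u) (m0 : 0 < m).
Hypothesis Q_ge0 : forall x y, Q x y -> 0 <= x /\ 0 <= y.
Hypothesis Q_lower : forall x y, Q x y -> m <= x + y.
Hypothesis Q_stretch : forall x y, Q x y ->
  Q (expR u * x) (expR (- u) * y) /\ Q (expR (- u) * x) (expR u * y).

Lemma stretched_iter x y n : Q x y ->
  Q (expR (u * n%:R) * x) (expR (- (u * n%:R)) * y) /\
  Q (expR (- (u * n%:R)) * x) (expR (u * n%:R) * y).
Proof.
move=> Qxy; elim: n => [|n [h1 h2]].
  by rewrite mulr0 oppr0 expR0 !mul1r.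
have {h1}[h1 _] := Q_stretch h1; have {h2}[_ h2] := Q_stretch h2.
by rewrite -[n.+1]add1n natrD mulrDr mulr1 opprD !expRD -!mulrA.
Qed.

Lemma contraction_small (x e : R) : 0 <= x -> 0 < e ->
  exists n : nat, expR (- (u * n%:R)) * x <= e.
Proof.
move=> x0 e0; have [n hn] : exists n : nat, x / e / u < n.+1%:R.
  exists (Num.truncn (x / e / u)); apply: truncnS_gt.
exists n.+1; rewrite expRN mulrC ler_pdivrMr ?expR_gt0 //.
(* The linear lower bound for the exponential is enough for this choice of [n]. *)
have := expR_ge1Dx (u * n.+1%:R) => h.
move: hn; rewrite ltr_pdivrMr // ltr_pdivrMr // => hn.
apply: le_trans (ltW hn) _; rewrite [leRHS]mulrC ler_pM2r //.
by apply: le_trans h; rewrite mulrC lerDr.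
Qed.

(** If one coordinate were zero, contracting the other below [m / 2] would contradict [Q_lower]. *)
Lemma stretched_gt0 x y : Q x y -> 0 < x /\ 0 < y.
Proof.
move=> Qxy; have [x0 y0] := Q_ge0 Qxy.
have m20 : 0 < m / 2 by rewrite divr_gt0.
split; rewrite lt_neqAle eq_sym ?x0 ?y0 andbT; apply/eqP => z0.
  have [n h] := contraction_small y0 m20.
  have [/Q_lower] := stretched_iter n Qxy; rewrite z0 mulr0 add0r; lra.
have [n h] := contraction_small x0 m20.
have [_ /Q_lower] := stretched_iter n Qxy; rewrite z0 mulr0 addr0; lra.
Qed.

(** Contract one coordinate below [delta] times the original value of the other, which meanwhile
    only grows. *)
Lemma stretched_asymptotic x y delta : Q x y -> 0 < delta ->
  (exists x' y', [/\ Q x' y', 0 < x' & y' <= delta * x']) /\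
  (exists x' y', [/\ Q x' y', 0 < y' & x' <= delta * y']).
Proof.
move=> Qxy d0; have [x0 y0] := stretched_gt0 Qxy.
have e1 n : 1 <= expR (u * n%:R).
  by rewrite -[leLHS]expR0 ler_expR mulr_ge0 // ltW.
split.
  have [n h] := contraction_small (ltW y0) (mulr_gt0 d0 x0).
  have [Qn _] := stretched_iter n Qxy; have [p0 _] := stretched_gt0 Qn.
  do 2 eexists; split; [exact: Qn|exact: p0|].
  by apply: le_trans h _; rewrite ler_pM2l // ler_peMl // ltW.
have [n h] := contraction_small (ltW x0) (mulr_gt0 d0 y0).
have [_ Qn] := stretched_iter n Qxy; have [_ p0] := stretched_gt0 Qn.
do 2 eexists; split; [exact: Qn|exact: p0|].
by apply: le_trans h _; rewrite ler_pM2l // ler_peMl // ltW.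
Qed.

End HyperbolicCoordinates.

(** * Pseudo-Anosov autoequivalences *)

(* An orbit drifting at speed [l] forces every displacement to be at least [l],
   by comparing the orbits of [s] and [x] after [n] steps and letting [n] grow. *)
Lemma displacement_lower_bound (R : realType) (M : Type) (X : set M)
    (d : M -> M -> \bar R) (g : M -> M) (s : M) (l : R) :
  (forall x, X x -> X (g x)) ->
  (forall x y, X x -> X y -> d (g x) (g y) = d x y) ->
  (forall x y, X x -> X y -> (0 <= d x y < +oo)%E) ->
  (forall x y z, X x -> X y -> X z -> (d x z <= d x y + d y z)%E) ->
  (forall x, X x -> (d x x <= 0)%E) ->
  X s -> (forall n, ((n%:R * l)%:E <= d s (iter n g s))%E) ->
  forall x, X x -> (l%:E <= d x (g x))%E.
Proof.
move=> gX g_isom d_fin tri d0 Xs drift x Xx.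
have Xiter n y : X y -> X (iter n g y) by elim: n => // n IHn /IHn/gX.
have fin y z : X y -> X z -> exists a : R, d y z = a%:E.
  move=> Xy Xz; have /andP[ge0 lty] := d_fin y z Xy Xz.
  by exists (fine (d y z)); rewrite fineK // ge0_fin_numE.
have [D dD] := fin x (g x) Xx (gX x Xx).
have [a da] := fin s x Xs Xx; have [b db] := fin x s Xx Xs.
rewrite dD lee_fin.
have iter_isom n y z : X y -> X z -> d (iter n g y) (iter n g z) = d y z.
  by move=> Xy Xz; elim: n => //= n IHn; rewrite g_isom //; exact: Xiter.
have step n : (d x (iter n g x) <= (n%:R * D)%:E)%E.
  elim: n => [|n IHn]; first by rewrite mul0r; exact: d0.
  apply: le_trans (tri _ (g x) _ Xx (gX _ Xx) (Xiter n.+1 _ Xx)) _.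
  rewrite iterS g_isom //; last exact: Xiter.
  by rewrite -natr1 mulrDl mul1r addrC EFinD dD; exact: leeD.
have bound n : n%:R * l <= a + n%:R * D + b.
  rewrite -lee_fin; apply: le_trans (drift n) _; rewrite !EFinD.
  apply: le_trans (tri _ _ _ Xs (Xiter n _ Xx) (Xiter n _ Xs)) _.
  rewrite iter_isom // db leeD //.
  by apply: le_trans (tri _ _ _ Xs Xx (Xiter n _ Xx)) _; rewrite da; exact: leeD.
rewrite leNgt; apply/negP => Dl; have lD : 0 < l - D by rewrite subr_gt0.
have := bound (Num.truncn ((a + b) / (l - D))).+1.
have := truncnS_gt ((a + b) / (l - D)); rewrite ltr_pdivrMr //; lra.
Qed.

Section PseudoAnosov.
Variables (R : realType) (k : fieldType) (T : tricat k).
Hypothesis T_nz : nonzero_category T.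
Variables (L : zmodType) (V : normedModType R) (iota : {additive L -> V}).
Hypothesis iotaP : is_scalar_extension iota.
Variables (v : {additive K0 T -> L}) (alpha : autoeq T -> zaut L).
Hypothesis alphaP : forall (F : autoeq T) (x : K0 T), v (K0_map F x) = alpha F (v x).
Variables (F : autoeq T) (G : functor T T).
Hypothesis FG : quasi_inverse F G.
Local Open Scope complex_scope.

Lemma actAut_quot_orbitC (sigma : prestab R T L) :
  actAut_quot alpha F (orbitC sigma) = orbitC (actAut alpha F sigma).
Proof.
apply/seteqP; split=> [_ [_ [lambda _ <-] <-]|_ [lambda _ <-]]; first by exists lambda.
by exists (actC sigma lambda) => //; exists lambda.
Qed.

Variables (sigma : stab iota v) (t n : R).
Hypotheses (n_int : sin (pi * n) = 0) (t0 : t != 0).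
Hypothesis F_sigma : actAut alpha F sigma = actC (flow sigma t) n%:C.

Let sP := stabP sigma.

Lemma flow_actC (s : R) (tau : prestab R T L) :
  flow (actC tau n%:C) s = actC (flow tau s) n%:C.
Proof.
congr pair; apply/funext => x /=; first by rewrite cexp_integer // stretchZ.
by rewrite turn_integer.
Qed.

Lemma actAut_flow s : actAut alpha F (flow sigma s) = actC (flow sigma (t + s)) n%:C.
Proof.
rewrite [LHS](_ : _ = flow (actAut alpha F sigma) s) //.
by rewrite F_sigma flow_actC flowD.
Qed.

(** Each application of [F] adds [t] to the flow time and acts by [n], which is invisible on
    orbits. *)
Lemma iter_actAut_quot m :
  iter m (actAut_quot alpha F) (orbitC sigma) = orbitC (flow sigma (m%:R * t)).
Proof.
elim: m => [|m IHm]; first by rewrite mul0r flow0.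
rewrite iterS IHm actAut_quot_orbitC actAut_flow orbitC_actC.
by rewrite -natr1 mulrDl mul1r addrC.
Qed.

Lemma actAut_charge x :
  (stab_val sigma).1 x = (cos (pi * n))%:C * stretch t ((stab_val sigma).1 (alpha F x)).
Proof.
have := congr1 (fun tau => tau.1 (alpha F x)) F_sigma.
by rewrite /= zaut_funK cexp_integer.
Qed.

Lemma actAut_coords E :
  `|complex.Re ((stab_val sigma).1 (vcl v E))|
    = expR t * `|complex.Re ((stab_val sigma).1 (vcl v (F E)))| /\
  `|complex.Im ((stab_val sigma).1 (vcl v E))|
    = expR (- t) * `|complex.Im ((stab_val sigma).1 (vcl v (F E)))|.
Proof.
have c1 : `|cos (pi * n)| = 1.
  apply/eqP; rewrite -sqrp_eq1 // real_normK ?num_real //.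
  by have := cos2Dsin2 (pi * n); rewrite n_int expr0n addr0 => ->.
rewrite actAut_charge (aut_vcl alphaP); case: ((stab_val sigma).1 _) => a b /=.
rewrite !mul0r subr0 addr0 !normrM c1 !mul1r !(ger0_norm (expR_ge0 _)).
by [].
Qed.

(** One pair belongs to [F E], the other to an object whose image under [F] is isomorphic to [E]. *)
Lemma semistable_coords_actAut x y : semistable_coords v sigma x y ->
  semistable_coords v sigma (expR (- t) * x) (expR t * y) /\
  semistable_coords v sigma (expR t * x) (expR (- t) * y).
Proof.
have pq : expR t * expR (- t) = 1 by rewrite -expRD subrr expR0.
have qp : expR (- t) * expR t = 1 by rewrite mulrC.
have phaseE phi : (actAut alpha F sigma).2 phi = (stab_val sigma).2 (turn t (phi + n)).
  by rewrite F_sigma.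
move=> [phi [E [E0 PE <- <-]]]; split.
  have [-> ->] := actAut_coords E; rewrite !mulrA pq qp !mul1r.
  exists (turn t (phi + n)), (F E); split=> //.
    by move=> /(quasi_inverse_zero_reflect FG).
  by rewrite -phaseE; exists E => //; exact: isom_refl.
(* This phase is the preimage of [phi] under the phase change of [F]. *)
have : (actAut alpha F sigma).2 (turn (- t) phi - n) E.
  by rewrite phaseE subrK turn_comp subrr turn0.
move=> [E' PE' EFE']; have [e1 e2] := actAut_coords E'.
rewrite (isom_vcl v EFE') -e1 -e2; exists (turn (- t) phi - n), E'; split=> //.
by move=> /(functor_zero F)/(isom_zero (isom_sym EFE')).
Qed.

(** By the support property a small central charge forces a small vector in the lattice, hence the
    zero vector; but its charge 0 cannot belong to a nonzero semistable object. *)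
Lemma semistable_coords_lower :
  exists2 m : R, 0 < m & forall x y, semistable_coords v sigma x y -> m <= x + y.
Proof.
have [C C0 supp] := stability_support sP.
have [e e0 disc] := scalar_extension_discrete iotaP.
exists (e / C); first exact: divr_gt0.
move=> x y [phi [E [E0 PE <- <-]]]; rewrite leNgt; apply/negP => lt_e.
have vE0 : vcl v E = 0.
  apply: disc; apply: lt_trans (supp _ _ E0 PE) _.
  move: lt_e; rewrite ltr_pdivlMr // mulrC; apply: le_lt_trans.
  by rewrite ler_pM2l //; exact: cmod_le_abs.
have Z0 : (stab_val sigma).1 0 = 0.
  by have /eqP := stability_addC sP 0 0; rewrite addr0 -subr_eq subrr => /eqP.
have := cmod_semistable_gt0 sP E0 PE; rewrite vE0 Z0.
by rewrite (cmodC (lexx 0)) ltxx.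
Qed.

Lemma semistable_coords_inhabited : exists x y, semistable_coords v sigma x y.
Proof.
have [E E0] := T_nz; have := HN_neq0 sP E0; have := HN_in sP E0.
case: (HN sigma E) => // a s /(_ a (mem_head _ _)) [A0 PA] _.
by do 2 eexists; exists a.1, a.2; split.
Qed.

(** The time [s] is arbitrary: [F], through [t != 0], supplies the semistable objects near the axes,
    and these bound every flow. *)
Lemma dB_flow_lower (s : R) lambda :
  (`|s|%:E <= dB v sigma (actC (flow sigma s) lambda))%E.
Proof.
have [m m0 Q_lower] := semistable_coords_lower.
have [x [y Qxy]] := semistable_coords_inhabited.
have Q_ge0 a b : semistable_coords v sigma a b -> 0 <= a /\ 0 <= b.
  by move=> [phi [E [_ _ <- <-]]].
have u0 : 0 < `|t| by rewrite normr_gt0.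
have Q_stretch a b : semistable_coords v sigma a b ->
    semistable_coords v sigma (expR `|t| * a) (expR (- `|t|) * b) /\
    semistable_coords v sigma (expR (- `|t|) * a) (expR `|t| * b).
  move=> /semistable_coords_actAut[h1 h2].
  have [t_ge0|/ltW t_le0] := leP 0 t; first by rewrite ger0_norm.
  by rewrite ler0_norm // opprK.
have asym := stretched_asymptotic u0 m0 Q_ge0 Q_lower Q_stretch Qxy.
by apply: (flow_lower_bound sP) => delta /asym[].
Qed.

Lemma dB_quot_flow (s : R) :
  dB_quot v (orbitC sigma) (orbitC (flow sigma s)) = `|s|%:E.
Proof.
have fP := is_stability_flow s sP.
apply/eqP; rewrite eq_le; apply/andP; split.
  apply: le_trans (dB_quot_le_dB sP fP) _.
  by have := dB_flow 0 s sP; rewrite flow0 sub0r normrN.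
rewrite (dB_quotE sP fP); apply: le_ereal_inf_tmp => _ [lambda _ <-].
exact: dB_flow_lower.
Qed.

Variable X : set (stab iota v).
Hypotheses (X_comp : is_component X) (X_sigma : X sigma).

Definition actAut_stab (tau : stab iota v) : stab iota v :=
  Stab (is_stability_actAut iotaP alphaP FG (stabP tau)).

Definition pullF_stab (tau : stab iota v) : stab iota v :=
  Stab (is_stability_pullF iotaP alphaP FG (stabP tau)).

Lemma actAut_stabK : cancel actAut_stab pullF_stab.
Proof. by move=> tau; apply: stab_eq; exact: (pullF_actAut alpha FG (stabP tau)). Qed.

Lemma pullF_stabK : cancel pullF_stab actAut_stab.
Proof.
by move=> tau; apply: stab_eq; exact: (actAut_pullF iotaP alphaP FG (stabP tau)).
Qed.

Lemma actAut_sigma_component : X (actAut_stab sigma).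
Proof.
(* The flow and the action of C are run simultaneously, so that the path ends at [F] applied to
   [sigma] itself and not merely in its orbit. *)
pose f (x : R) : stab iota v := Stab (is_stability_actC (x * n)%:C
  (is_stability_flow (x * t) sP)).
have f0 : f 0 = sigma.
  by apply: stab_eq; rewrite /= !mul0r flow0 actC0.
have f1 : f 1 = actAut_stab sigma.
  by apply: stab_eq; rewrite /= !mul1r F_sigma.
rewrite -f1; apply: (component_path X_comp (f := f) (K := `|n| + `|t|) (s := 0)).
  move=> x y.
  have P1 := is_stability_flow (x * t) sP; have P2 := is_stability_flow (y * t) sP.
  apply: le_trans (dB_triangle (is_stability_actC (x * n)%:C P1)
    (is_stability_actC (y * n)%:C P1) (is_stability_actC (y * n)%:C P2)) _.
  rewrite mulrDl EFinD; apply: leeD.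
    apply: le_trans (dB_actC_lip _ _ P1) _.
    by rewrite lee_fin /= subrr normr0 mulr0 addr0 -mulrBl normrM mulrC.
  rewrite (dB_actC _ P1 P2); apply: le_trans (dB_flow _ _ sP) _.
  by rewrite lee_fin -mulrBl normrM mulrC.
by rewrite f0.
Qed.

Lemma actAut_component tau : X tau -> X (actAut_stab tau).
Proof.
apply: (component_image X_comp _ X_sigma actAut_sigma_component) => a b.
exact: (dB_actAut iotaP alphaP FG (stabP a) (stabP b)).
Qed.

Lemma pullF_component tau : X tau -> X (pullF_stab tau).
Proof.
apply: (component_image X_comp _ actAut_sigma_component).
  by move=> a b; exact: (dB_pullF iotaP alphaP FG (stabP a) (stabP b)).
by rewrite actAut_stabK.
Qed.

Let Fbar := actAut_quot (R := R) alpha F.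
Let d := dB_quot (R := R) v.

Lemma dB_quot_actAut (tau rho : stab iota v) :
  d (Fbar (orbitC tau)) (Fbar (orbitC rho)) = d (orbitC tau) (orbitC rho).
Proof.
have [tP rP] := (stabP tau, stabP rho).
have FtP := is_stability_actAut iotaP alphaP FG tP.
have FrP := is_stability_actAut iotaP alphaP FG rP.
rewrite /Fbar !actAut_quot_orbitC /d (dB_quotE FtP FrP) (dB_quotE tP rP).
have e lambda : dB v (actAut alpha F tau) (actC (actAut alpha F rho) lambda)
    = dB v tau (actC rho lambda).
  exact: (dB_actAut iotaP alphaP FG tP (is_stability_actC lambda rP)).
by congr ereal_inf; apply/seteqP; split=> _ [lambda _ <-]; exists lambda; rewrite ?e.
Qed.

Lemma actAut_quot_isometry : is_isometry (quotientC X) d Fbar.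
Proof.
split; last first.
  by move=> _ _ [tau _ <-] [rho _ <-]; exact: dB_quot_actAut.
split.
- move=> _ [tau Xtau <-]; exists (actAut_stab tau); first exact: actAut_component.
  by rewrite /Fbar actAut_quot_orbitC.
- move=> _ _ /set_mem[tau Xtau <-] /set_mem[rho Xrho <-].
  rewrite /Fbar !actAut_quot_orbitC => e.
  (* Injectivity: an equality of image orbits yields a [lambda] relating the images, and pulling
     back along [F] relates [tau] and [rho] by the same [lambda]. *)
  have : orbitC (actAut alpha F tau) (actAut alpha F tau).
    by exists 0 => //; exact: actC0.
  rewrite e => -[lambda _ Frho].
  have := congr1 (pullback F (alpha F)) Frho.
  rewrite -[actC (actAut _ _ _) _]/(actAut alpha F (actC rho lambda)).
  rewrite (pullF_actAut alpha FG (is_stability_actC lambda (stabP rho))).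
  by rewrite (pullF_actAut alpha FG (stabP tau)) => <-; rewrite orbitC_actC.
- move=> _ [tau Xtau <-]; exists (orbitC (pullF_stab tau)).
    by exists (pullF_stab tau) => //; exact: pullF_component.
  rewrite /Fbar actAut_quot_orbitC.
  by rewrite -[actAut alpha F _]/(stab_val (actAut_stab (pullF_stab tau))) pullF_stabK.
Qed.

Lemma dB_quot_component (tau rho : stab iota v) : X tau -> X rho ->
  (0 <= d (orbitC tau) (orbitC rho) < +oo)%E.
Proof.
move=> Xtau Xrho; rewrite (dB_quot_ge0 T_nz (stabP tau) (stabP rho)) /=.
apply: le_lt_trans (dB_quot_le_dB (stabP tau) (stabP rho)) _.
exact: (component_dB_fin X_comp Xtau Xrho).
Qed.

Lemma actAut_quot_displacement : d (orbitC sigma) (Fbar (orbitC sigma)) = `|t|%:E.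
Proof.
by rewrite -[Fbar _]/(iter 1 Fbar _) iter_actAut_quot mul1r /d dB_quot_flow.
Qed.

(** The orbit of [sigma] realizes the value; [displacement_lower_bound], with drift [|t|] along that
    orbit, bounds all other displacements. *)
Lemma actAut_quot_translation_length :
  translation_length (quotientC X) d Fbar = `|t|%:E.
Proof.
have Xbar_sigma : quotientC X (orbitC sigma) by exists sigma.
apply/eqP; rewrite eq_le; apply/andP; split.
  rewrite -actAut_quot_displacement.
  by apply: ereal_inf_lbound; exists (orbitC sigma).
apply: le_ereal_inf_tmp => _ [A XA <-].
have [[FX _ _] F_isom] := actAut_quot_isometry.
apply: (displacement_lower_bound (X := quotientC X) (s := orbitC sigma)) => //.
- by move=> _ _ [tau Xtau <-] [rho Xrho <-]; exact: dB_quot_component.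
- move=> _ _ _ [a _ <-] [b _ <-] [c _ <-].
  exact: (dB_quot_triangle T_nz (stabP a) (stabP b) (stabP c)).
- move=> _ [tau _ <-].
  exact: (le_trans (dB_quot_le_dB (stabP tau) (stabP tau)) (dB_refl (stabP tau))).
- by move=> m; rewrite iter_actAut_quot /d dB_quot_flow normrM normr_nat.
Qed.

End PseudoAnosov.

Theorem theorem4p9 (R : realType) (k : fieldType) (T : tricat k)
  (T_fin : finite_type T) (T_nz : nonzero_category T)
  (L : zmodType) (V : normedModType R) (iota : {additive L -> V})
  (iotaP : is_scalar_extension iota)
  (v : {additive K0 T -> L}) (v_surj : forall x : L, exists y, v y = x)
  (alpha : autoeq T -> zaut L) (alpha_morph : aut_morphism alpha)
  (alphaP : forall (F : autoeq T) (x : K0 T), v (K0_map F x) = alpha F (v x))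
  (Sdag : set (stab iota v)) (Sdag_comp : is_component Sdag)
  (F : autoeq T) (sigmaF : stab iota v) (rhoF : R)
  (sigmaF_in : Sdag sigmaF) (F_pA : pseudo_Anosov alpha F sigmaF rhoF) :
  let X := quotientC Sdag in
  let d := dB_quot v in
  let Fbar := actAut_quot alpha F in
  let sbar := orbitC sigmaF in
  [/\ hyperbolic_isometry X d Fbar,
      translation_length X d Fbar = (ln rhoF)%:E
    & (fun n : nat => ((n%:R^-1)%:E * d sbar (iter n Fbar sbar))%E) @ \oo
        --> (ln rhoF)%:E].
Proof.
move=> X d Fbar sbar.
have [G FG] := aut_equiv F.
have [g [r [r1 F_sigma gmx ->]]] := F_pA.
have [t [n [tE n_int glE actE]]] := GLtilde_turn r1 gmx.
have lnr0 : 0 < ln `|r| by rewrite ln_gt0.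
have t0 : t != 0 by rewrite -normr_gt0 tE.
have F_flow : actAut alpha F sigmaF = actC (flow sigmaF t) n%:C%C.
  (* On phases the two sides add [n] after and before [turn t]; these agree because [n] is an
     integer. *)
  rewrite F_sigma; congr pair; apply/funext => x /=; first exact: actE.
  by rewrite glE turn_integer.
have tl := actAut_quot_translation_length T_nz iotaP alphaP FG n_int t0 F_flow
  Sdag_comp sigmaF_in.
rewrite -tE; split=> //.
- split.
  + exact: (actAut_quot_isometry iotaP alphaP FG F_flow Sdag_comp sigmaF_in).
  + by rewrite tl lte_fin tE.
  + exists sbar; first by exists sigmaF.
    rewrite tl /d /sbar /Fbar.
    by rewrite (actAut_quot_displacement T_nz iotaP alphaP FG n_int t0 F_flow).
(* The sequence is constant from index 1 on; at index 0 the inverse has the default value 0. *)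
- apply: cvg_near_cst; near=> m.
  have m0 : (0 < m)%N by near: m; exact: nbhs_infty_gt.
  rewrite /d /sbar /Fbar (iter_actAut_quot n_int F_flow).
  rewrite (dB_quot_flow T_nz iotaP alphaP FG n_int t0 F_flow).
  by rewrite normrM normr_nat -EFinM mulrA mulVf ?mul1r // pnatr_eq0 -lt0n.
Unshelve. all: by end_near.
Qed.
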